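(* For all real $z>0$, $$\begin{aligned}&S_{4,2}(1-e^{2z})+S_{4,2}(1-e^{-2z})+S_{4,2}(e^{-2z})\\&\quad=2\left(\operatorname{Li}_6(1-e^{2z})+\operatorname{Li}_6(1-e^{-2z})+\operatorname{Li}_6(e^{-2z})\right)\\&\qquad-z\left(2\operatorname{Li}_5(1-e^{2z})-2\operatorname{Li}_5(1-e^{-2z})-\operatorname{Li}_5(e^{-2z})\right)-\log(2\sinh z)\operatorname{Li}_5(e^{-2z})\\&\qquad+\log(2\sinh z)\left(\frac{2z^5}{15}+\zeta(5)-2z\zeta(4)+2z^2\zeta(3)-\frac{4z^3}{3}\zeta(2)\right)-\frac{z^4}{3}\log(2\sinh z)^2\\&\qquad-\frac{z^6}{15}-\frac{2z^3}{3}\zeta(3)-\frac{3z^2}{2}\zeta(4)+2z\zeta(2)\zeta(3)-z\zeta(5)-\frac54\zeta(6)-\frac{\zeta(3)^2}{2}.\end{aligned}$$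
   Context: For integers $m,k\ge1$ and $x\in\mathbb{C}\setminus[1,\infty)$ the Nielsen polylogarithm is $$S_{m,k}(x)=\frac{(-1)^{m+k-1}}{(m-1)!\,k!}\int_0^1 \log(t)^{m-1}\log(1-xt)^k\,\frac{dt}{t}$$ with the principal branch of the logarithm. $\operatorname{Li}_m(x)=\sum_{n\ge1}x^n n^{-m}$ for $|x|<1$ is the polylogarithm, extended by analytic continuation to $\mathbb{C}\setminus[1,\infty)$ (principal branch). $\zeta$ is the Riemann zeta function. $\log(y)^2$ means $(\log y)^2$. *)

(* Defs.v *)
From Stdlib Require Import Reals Factorial ClassicalEpsilon.
From Coquelicot Require Import Coquelicot.

Open Scope R_scope.

(* Values in (-PI, PI] for w <> 0; Carg 0 and Clog 0 are junk. *)
Definition Carg (w : C) : R :=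
  if Rle_dec 0 (Im w) then acos (Re w / Cmod w) else - acos (Re w / Cmod w).

Definition Clog (w : C) : C := (ln (Cmod w), Carg w).

(* C minus the ray [1, +oo) *)
Definition cut_plane (x : C) : Prop := ~ (Im x = 0 /\ 1 <= Re x).

(* The integral is improper at both ends: for m >= 2 and k = 1 the integrand is
   unbounded near 0.  Meaningful for m, k >= 1 and x in cut_plane. *)
Definition nielsen (m k : nat) (x : C) : C :=
  (RtoC ((-1) ^ (m + k - 1) / (INR (fact (m - 1)) * INR (fact k))) *
   RInt_gen (V := C_R_CompleteNormedModule)
     (fun t : R =>
        RtoC (ln t) ^ (m - 1) * Clog (RtoC 1 - x * RtoC t) ^ k / RtoC t)
     (at_right 0) (at_left 1))%C.

Definition analytic_at (f : C -> C) (x0 : C) : Prop :=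
  exists a : nat -> C,
    locally (T := C_UniformSpace) x0
      (fun x : C => is_pseries (V := C_NormedModule) a (x - x0)%C (f x)).

Definition is_polylog (m : nat) (f : C -> C) : Prop :=
  (forall x : C, Cmod x < 1 ->
     is_series (V := C_NormedModule)
       (fun n : nat => x ^ (S n) / RtoC (INR (S n)) ^ m)%C (f x)) /\
  (forall x : C, cut_plane x -> analytic_at f x).

(* Since cut_plane is connected, is_polylog m determines its solution there;
   on the ray [1, +oo) the value of Li is arbitrary. *)
Definition Li (m : nat) : C -> C :=
  epsilon (inhabits (fun _ : C => RtoC 0)) (is_polylog m).

(* Only the values at integers s >= 2 are needed, where the series converges. *)
Definition zeta (s : nat) : R := Series (fun n : nat => / INR (S n) ^ s).

(* Main.v *)
Require Import Defs.
From Stdlib Require Import Reals Lra Lia Factorial ClassicalEpsilon.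
From Coquelicot Require Import Coquelicot.

(** Every term of the identity is real: the three arguments 1 - e^{2z}, 1 - e^{-2z}
    and e^{-2z} are real and smaller than 1.  On (-oo, 1) both families are towers
    of iterated integrals, x d/dx F_{k+1} = F_k, starting from x / (1 - x) for Li
    and from ln(1 - x)^2 / 2 for S_{k,2}.  Along the three arguments x d/dx turns
    into d/dz up to the factors w = coth z + 1, w - 2 and -2, and ln(2 sinh z) has
    derivative w - 1.  So the derivative of the difference of the two sides has
    the form w P + 2 Q, where P and Q are again combinations of polylogarithms,
    now of weight 5.  Each of them vanishes identically for the same reason, and
    the descent ends at weight 2 with the reflection formulas of the dilogarithm,
    which involve only elementary functions after one more derivative (lemmas
    [E2_far_zero] to [E6_zero]).

    At every level the constant of integration is read off as z tends to 0+.  There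
    the first two arguments tend to 0, where all functions vanish, and the third
    tends to 1.  Hence the constants are zeta values together with
    S_{k,2}(1) = zeta(k+1, 1), k = 1, ..., 4, which Euler expressed by zeta values
    ([euler_linear_sum]).  Weights 4 and 6 also need zeta(2)^2 = 5/2 zeta(4) and
    zeta(2) zeta(4) = 7/4 zeta(6) ([even_zeta_convolution]).  Both facts come from
    finite double sums of partial fractions, with an explicit error term.

    It remains to recognize the complex functions.  The integral that defines
    S_{k,2} is computed by repeated integration by parts ([log_primitive]).  The
    same computation shows that the integral of (-ln t)^n / n! * x / (1 - x t) over
    (0, 1) is the real tower of Li_{n+1}; as a function of a complex x this integral
    is analytic off the cut and has the right Taylor series at 0
    ([is_polylog_integral]), and an identity theorem along the half-line
    ([analytic_zero]) shows that no other continuation is possible at the real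
    points. *)

Open Scope R_scope.

(** * Finite sums *)

(** Sums start at index 1, so that the n-th term of a Dirichlet series carries the
    index n. *)

Fixpoint psum (f : nat -> R) (N : nat) : R :=
  match N with O => 0 | S n => psum f n + f (S n) end.

Definition harm (N : nat) : R := psum (fun n => / INR n) N.

Definition zsum (s N : nat) : R := psum (fun n => (/ INR n) ^ s) N.

Lemma psum_S f N : psum f (S N) = psum f N + f (S N).
Proof. reflexivity. Qed.

Lemma psum_ext f g N :
  (forall n, (1 <= n <= N)%nat -> f n = g n) -> psum f N = psum g N.
Proof.
  induction N as [|N IH]; intros H; simpl; auto.
  rewrite IH, H; auto; try lia. intros n Hn; apply H; lia.
Qed.

Lemma psum_le f g N :
  (forall n, (1 <= n <= N)%nat -> f n <= g n) -> psum f N <= psum g N.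
Proof.
  induction N as [|N IH]; intros H; simpl; [lra|].
  apply Rplus_le_compat; [apply IH; intros n Hn|]; apply H; lia.
Qed.

Lemma psum_const_zero N : psum (fun _ => 0) N = 0.
Proof. induction N as [|N IH]; simpl; lra. Qed.

Lemma psum_nonneg f N : (forall n, (1 <= n <= N)%nat -> 0 <= f n) -> 0 <= psum f N.
Proof. intros H. rewrite <- (psum_const_zero N). now apply psum_le. Qed.

Lemma psum_plus f g N : psum (fun n => f n + g n) N = psum f N + psum g N.
Proof. induction N as [|N IH]; simpl; lra. Qed.

Lemma psum_scal c f N : psum (fun n => c * f n) N = c * psum f N.
Proof. induction N as [|N IH]; simpl; [ring|rewrite IH; ring]. Qed.

Lemma psum_swap (f : nat -> nat -> R) N M :
  psum (fun n => psum (fun m => f n m) M) N = psum (fun m => psum (fun n => f n m) N) M.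
Proof.
  induction N as [|N IH]; simpl.
  - now rewrite psum_const_zero.
  - rewrite IH. now rewrite <- psum_plus.
Qed.

Lemma psum_mult f g N M :
  psum f N * psum g M = psum (fun n => psum (fun m => f n * g m) M) N.
Proof.
  induction N as [|N IH]; simpl; [ring|].
  rewrite <- IH, psum_scal. ring.
Qed.

Lemma psum_first f N : psum f (S N) = f 1%nat + psum (fun n => f (S n)) N.
Proof.
  induction N as [|N IH]; [simpl; ring|].
  change (psum f (S (S N))) with (psum f (S N) + f (S (S N))).
  rewrite IH. simpl. ring.
Qed.

Lemma psum_rev f N : psum (fun n => f (S N - n)%nat) N = psum f N.
Proof.
  induction N as [|N IH]; [reflexivity|].
  rewrite psum_first. simpl. rewrite <- IH.
  rewrite Rplus_comm. f_equal. 
Qed.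

Lemma psum_kronecker (d : nat -> R) n N : (1 <= n <= N)%nat ->
  psum (fun m => if Nat.eq_dec m n then d m else 0) N = d n.
Proof.
  intros Hn. induction N as [|N IH]; [lia|]. rewrite psum_S.
  destruct (Nat.eq_dec (S N) n) as [<-|Hd].
  - rewrite (psum_ext _ (fun _ => 0)), psum_const_zero; [lra|].
    intros m Hm. destruct (Nat.eq_dec m (S N)); [lia|reflexivity].
  - rewrite IH; [lra|lia].
Qed.

(** Summing a symmetric kernel over a square: the two orientations contribute
    equally, and the diagonal is separated because the kernels used below are
    differences of powers divided by a difference of indices. *)
Lemma psum_symmetrized (s k : nat -> nat -> R) (d : nat -> R) N :
  (forall n m, (1 <= n <= N)%nat -> (1 <= m <= N)%nat ->
     s n m = k n m + k m n + (if Nat.eq_dec m n then d m else 0)) ->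
  psum (fun n => psum (fun m => s n m) N) N =
  2 * psum (fun n => psum (fun m => k n m) N) N + psum d N.
Proof.
  intros H.
  rewrite (psum_ext _ (fun n => psum (fun m => k n m) N + psum (fun m => k m n) N + d n)).
  - rewrite !psum_plus, (psum_swap (fun n m => k m n)). ring.
  - intros n Hn. rewrite <- (psum_kronecker d n N Hn), <- !psum_plus.
    apply psum_ext; intros m Hm. now apply H.
Qed.

Lemma psum_geometric a b p :
  (a - b) * psum (fun j => a ^ (j - 1) * b ^ (p - j)) p = a ^ p - b ^ p.
Proof.
  induction p as [|p IH]; [simpl; ring|].
  change (psum _ (S p)) with
    (psum (fun j => a ^ (j - 1) * b ^ (S p - j)) p + a ^ (S p - 1) * b ^ (S p - S p)).
  rewrite (psum_ext _ (fun j => b * (a ^ (j - 1) * b ^ (p - j)))).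
  - rewrite psum_scal, Nat.sub_diag.
    replace (S p - 1)%nat with p by lia.
    replace ((a - b) * _) with
      (b * ((a - b) * psum (fun j => a ^ (j - 1) * b ^ (p - j)) p) + (a - b) * a ^ p)
      by (simpl; ring).
    rewrite IH. simpl. ring.
  - intros j Hj. replace (S p - j)%nat with (S (p - j)) by lia. simpl. ring.
Qed.

Lemma INR_gt0 n : (1 <= n)%nat -> 0 < INR n.
Proof. intros H. apply lt_0_INR. lia. Qed.

(** Since [/ 0 = 0], the index m = n is skipped without a side condition. *)
Lemma psum_inv_sub n N : (1 <= n <= N)%nat ->
  psum (fun m => / (INR m - INR n)) N = harm (N - n) - harm (n - 1).
Proof.
  intros Hn.
  assert (Hlow : forall M, (M < n)%nat ->
    psum (fun m => / (INR m - INR n)) M = harm (n - 1 - M) - harm (n - 1)).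
  { induction M as [|M IH]; intros HM.
    - simpl psum. replace (n - 1 - 0)%nat with (n - 1)%nat by lia. ring.
    - rewrite psum_S, IH by lia.
      replace (n - 1 - M)%nat with (S (n - 1 - S M)) by lia.
      change (harm (S (n - 1 - S M))) with (harm (n - 1 - S M) + / INR (S (n - 1 - S M))).
      replace (INR (S M) - INR n) with (- INR (S (n - 1 - S M))).
      + assert (0 < INR (S (n - 1 - S M))) by (apply INR_gt0; lia). field. lra.
      + rewrite <- (Nat.sub_add (S (n - 1 - S M)) n) at 2 by lia.
        rewrite plus_INR. replace (n - S (n - 1 - S M))%nat with (S M) by lia. ring. }
  replace N with (n + (N - n))%nat at 1 by lia.
  generalize (N - n)%nat as k. induction k as [|k IH].
  - rewrite Nat.add_0_r. destruct n as [|n]; [lia|]. rewrite psum_S.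
    rewrite Hlow by lia. rewrite Rminus_diag, Rinv_0.
    replace (S n - 1 - n)%nat with 0%nat by lia. unfold harm at 1 3. simpl. ring.
  - rewrite Nat.add_succ_r. rewrite psum_S. rewrite IH.
    change (harm (S k)) with (harm k + / INR (S k)).
    rewrite <- Nat.add_succ_r, plus_INR.
    replace (INR n + INR (S k) - INR n) with (INR (S k)) by ring. ring.
Qed.

Lemma psum_inv_add n N :
  psum (fun m => / (INR m + INR n)) N = harm (N + n) - harm n.
Proof.
  induction N as [|N IH]; [simpl; ring|].
  rewrite psum_S.
  rewrite IH, <- plus_INR.
  change (harm (S N + n)) with (harm (N + n) + / INR (S N + n)). ring.
Qed.

Lemma harm_diff_bounds M k : 0 <= harm (M + k) - harm M <= INR k / INR (S M).
Proof.
  induction k as [|k IH].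
  - rewrite Nat.add_0_r. simpl INR at 1. unfold Rdiv. lra.
  - rewrite Nat.add_succ_r.
    change (harm (S (M + k))) with (harm (M + k) + / INR (S (M + k))).
    assert (0 < / INR (S (M + k))) by (apply Rinv_0_lt_compat, INR_gt0; lia).
    assert (/ INR (S (M + k)) <= / INR (S M))
      by (apply Rinv_le_contravar; [apply INR_gt0; lia| apply le_INR; lia]).
    rewrite (S_INR k). unfold Rdiv in *. rewrite Rmult_plus_distr_r. lra.
Qed.

Lemma is_lim_seq_harm_avg : is_lim_seq (fun N => harm N / INR (S N)) 0.
Proof.
  apply (is_lim_seq_incr_1 (fun N => harm N / INR (S N))).
  assert (Hz : Un_cv (fun n => / INR (S n)) 0).
  { apply is_lim_seq_Reals.
    apply (is_lim_seq_incr_1 (fun n => / INR n)).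
    apply (is_lim_seq_inv _ p_infty); [apply is_lim_seq_INR|discriminate]. }
  pose proof (proj2 (is_lim_seq_Reals _ _) (Cesaro_1 _ _ Hz)) as H.
  apply (is_lim_seq_incr_1 _ _) in H.
  apply (is_lim_seq_le_le (fun _ => 0) _ _ 0) with (3 := H); [|apply is_lim_seq_const].
  intros N.
  assert (E : forall k, sum_f_R0 (fun n => / INR (S n)) k = harm (S k)).
  { induction k as [|k IH]; [unfold harm; simpl; ring|].
    change (sum_f_R0 (fun n => / INR (S n)) k + / INR (S (S k)) = harm (S k) + / INR (S (S k))).
    now rewrite IH. }
  change (Init.Nat.pred (S N)) with N.
  rewrite E.
  assert (Hp : 0 <= harm (S N)).
  { apply psum_nonneg. intros n Hn. left. apply Rinv_0_lt_compat, INR_gt0; lia. }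
  assert (H1 : 0 < INR (S N)) by (apply INR_gt0; lia).
  assert (H2 : INR (S N) <= INR (S (S N))) by (apply le_INR; lia).
  split.
  - apply Rmult_le_pos; [easy|]. left. apply Rinv_0_lt_compat. lra.
  - apply Rmult_le_compat_l; [easy|]. now apply Rinv_le_contravar.
Qed.

(** * Euler's linear sums and products of even zeta values *)

(** The truncation errors of both finite identities below are dominated by the
    convolution of the harmonic sequence with its reverse, which telescopes to
    2 H_N / (N + 1). *)
Lemma is_lim_seq_convolution_bound (t : nat -> nat -> R) :
  (forall N n, (1 <= n <= N)%nat -> 0 <= t N n <= / (INR n * INR (S N - n))) ->
  is_lim_seq (fun N => psum (t N) N) 0.
Proof.
  intros H.
  apply (is_lim_seq_le_le (fun _ => 0) _ (fun N => 2 * (harm N / INR (S N))) 0).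
  - intros N. split; [apply psum_nonneg; intros n Hn; now apply H|].
    replace (2 * (harm N / INR (S N))) with
      (/ INR (S N) * (psum (fun n => / INR n) N + psum (fun n => / INR (S N - n)) N)).
    2:{ rewrite (psum_rev (fun n => / INR n) N). unfold harm, Rdiv. ring. }
    rewrite <- psum_plus, <- psum_scal. apply psum_le. intros n Hn.
    eapply Rle_trans; [apply H; assumption|].
    assert (0 < INR n) by (apply INR_gt0; lia).
    assert (0 < INR (S N - n)) by (apply INR_gt0; lia).
    assert (INR (S N) = INR n + INR (S N - n)) by (rewrite <- plus_INR; f_equal; lia).
    right. rewrite H2. field. lra.
  - apply is_lim_seq_const.
  - replace 0 with (2 * 0) by ring. apply is_lim_seq_mult';
      [apply is_lim_seq_const| apply is_lim_seq_harm_avg].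
Qed.

Lemma is_lim_seq_psum_series (f : nat -> R) (l : R) :
  is_lim_seq (psum f) l <-> is_series (fun n => f (S n)) l.
Proof.
  assert (E : forall N, sum_n (fun n => f (S n)) N = psum f (S N)).
  { induction N as [|N IH]; [rewrite sum_O; simpl; ring|].
    rewrite sum_Sn, IH. reflexivity. }
  split; intros H.
  - apply (is_lim_seq_incr_1 _ _) in H.
    apply (is_lim_seq_ext _ _ _ (fun N => eq_sym (E N))) in H. exact H.
  - apply is_lim_seq_incr_1. now apply (is_lim_seq_ext _ _ _ E).
Qed.

Lemma is_lim_seq_zsum s : (2 <= s)%nat -> is_lim_seq (zsum s) (zeta s).
Proof.
  intros Hs.
  (* 1 / (x + 1)^2 <= 1 / x - 1 / (x + 1) telescopes to the bound 2 - 1 / N *)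
  assert (Hex : ex_finite_lim_seq (zsum s)).
  { apply ex_finite_lim_seq_incr with (M := 2).
    - intros N. unfold zsum. rewrite psum_S.
      assert (0 <= (/ INR (S N)) ^ s); [|lra].
      apply pow_le. left. apply Rinv_0_lt_compat, INR_gt0; lia.
    - assert (Hb : forall N, zsum s (S N) <= 2 - / INR (S N)).
      { induction N as [|N IH].
        - unfold zsum. simpl. rewrite Rinv_1, pow1. lra.
        - unfold zsum in *. rewrite ?psum_S in *.
          assert (0 < INR (S N)) by (apply INR_gt0; lia).
          assert (E : INR (S (S N)) = INR (S N) + 1) by apply S_INR.
          rewrite E. set (x := INR (S N)) in *.
          assert (1 <= x + 1) by lra.
          assert (Hq : (/ (x + 1)) ^ s <= / x - / (x + 1)).
          { apply Rle_trans with ((/ (x + 1)) ^ 2).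
            - replace s with (2 + (s - 2))%nat by lia. rewrite pow_add.
              rewrite <- (Rmult_1_r ((/ (x + 1)) ^ 2)) at 2.
              apply Rmult_le_compat_l; [apply pow2_ge_0|].
              assert (Hr : 0 <= / (x + 1) <= 1).
              { split; [left; apply Rinv_0_lt_compat; lra|].
                generalize (Rinv_le_contravar 1 (x + 1) Rlt_0_1 ltac:(lra)).
                rewrite Rinv_1. lra. }
              generalize (pow_incr _ _ (s - 2) Hr). now rewrite pow1.
            - assert (/ x - / (x + 1) - (/ (x + 1)) ^ 2 = / (x * (x + 1) ^ 2))
                by (field; lra).
              assert (0 < / (x * (x + 1) ^ 2)).
              { apply Rinv_0_lt_compat. apply Rmult_lt_0_compat; [lra|].
                apply pow_lt. lra. }
              lra. }
          lra. }
      intros [|N]; [unfold zsum; simpl; lra|].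
      specialize (Hb N). assert (0 < / INR (S N)) by (apply Rinv_0_lt_compat, INR_gt0; lia).
      lra. }
  destruct Hex as [l Hl].
  assert (Hl' := proj1 (is_lim_seq_psum_series _ _) Hl).
  replace (zeta s) with l; [exact Hl|].
  unfold zeta. symmetry. apply is_series_unique.
  eapply is_series_ext; [|exact Hl'].
  intros n. simpl. now rewrite pow_inv.
Qed.

(** For n <> m the geometric sum is (n^-p - m^-p) / (n m (m - n)), whose two halves
    are exchanged by swapping n and m. *)
Lemma euler_kernel p n m : (1 <= n)%nat -> (1 <= m)%nat ->
  psum (fun j => (/ INR n) ^ (j + 1) * (/ INR m) ^ (p + 2 - j)) p =
  (/ INR n) ^ (p + 1) * (/ INR m * / (INR m - INR n))
  + (/ INR m) ^ (p + 1) * (/ INR n * / (INR n - INR m))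
  + (if Nat.eq_dec m n then INR p * (/ INR m) ^ (p + 3) else 0).
Proof.
  intros Hn Hm.
  assert (0 < INR n) by now apply INR_gt0.
  assert (0 < INR m) by now apply INR_gt0.
  destruct (Nat.eq_dec m n) as [->|Hd].
  - rewrite Rminus_diag, Rinv_0.
    rewrite (psum_ext _ (fun _ => (/ INR n) ^ (p + 3) * 1)).
    + rewrite psum_scal.
      assert (E : forall q, psum (fun _ => 1) q = INR q).
      { induction q as [|q IH]; [reflexivity|]. rewrite S_INR. rewrite psum_S. lra. }
      rewrite E. ring.
    + intros j Hj. rewrite <- pow_add, Rmult_1_r. f_equal. lia.
  - assert (INR n <> INR m) by (intros E; apply INR_eq in E; lia).
    rewrite (psum_ext _ (fun j => ((/ INR n) ^ 2 * (/ INR m) ^ 2)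
               * ((/ INR n) ^ (j - 1) * (/ INR m) ^ (p - j)))).
    + rewrite psum_scal.
      assert (G := psum_geometric (/ INR n) (/ INR m) p).
      set (Q := psum _ p) in *.
      replace ((/ INR n) ^ 2 * (/ INR m) ^ 2 * Q) with
        (/ INR n * / INR m * / (INR m - INR n) * ((/ INR n - / INR m) * Q))
        by (field; lra).
      rewrite G, !pow_add, !pow_1. field. lra.
    + intros j Hj.
      replace (j + 1)%nat with (2 + (j - 1))%nat by lia.
      replace (p + 2 - j)%nat with (2 + (p - j))%nat by lia.
      rewrite !pow_add. ring.
Qed.

(** Euler's linear sum at a finite height.  The product of two truncated zeta
    values is a sum over a square; adding the products of fixed weight makes a
    geometric sum, whose denominator is summed in closed form. *)
Lemma euler_finite p N :
  psum (fun j => zsum (j + 1) N * zsum (p + 2 - j) N) p =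
  INR (p + 2) * zsum (p + 3) N
  - 2 * psum (fun n => harm (n - 1) * (/ INR n) ^ (p + 2)) N
  - 2 * psum (fun n => (/ INR n) ^ (p + 2) * (harm N - harm (N - n))) N.
Proof.
  unfold zsum at 1 2.
  rewrite (psum_ext _ (fun j => psum (fun n => psum (fun m =>
      (/ INR n) ^ (j + 1) * (/ INR m) ^ (p + 2 - j)) N) N))
    by (intros; apply psum_mult).
  rewrite psum_swap.
  rewrite (psum_ext _ (fun n => psum (fun m => psum (fun j =>
      (/ INR n) ^ (j + 1) * (/ INR m) ^ (p + 2 - j)) p) N))
    by (intros; apply psum_swap).
  rewrite (psum_symmetrized _ (fun n m => (/ INR n) ^ (p + 1) * (/ INR m * / (INR m - INR n)))
             (fun m => INR p * (/ INR m) ^ (p + 3)))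
    by (intros n m Hn Hm; apply euler_kernel; lia).
  rewrite psum_scal. fold (zsum (p + 3) N).
  rewrite (psum_ext _ (fun n => (/ INR n) ^ (p + 3)
      + (-1) * (harm (n - 1) * (/ INR n) ^ (p + 2))
      + (-1) * ((/ INR n) ^ (p + 2) * (harm N - harm (N - n))))).
  - rewrite !psum_plus, !psum_scal. fold (zsum (p + 3) N). rewrite plus_INR. simpl (INR 2). ring.
  - intros n Hn. assert (0 < INR n) by (apply INR_gt0; lia).
    rewrite psum_scal.
    rewrite (psum_ext _ (fun m => / INR n * (/ (INR m - INR n) + (-1) * / INR m
                + (if Nat.eq_dec m n then / INR m else 0)))).
    + rewrite psum_scal, !psum_plus, psum_scal, psum_inv_sub by lia.
      rewrite (psum_kronecker (fun m => / INR m)) by lia.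
      fold (harm N). rewrite !pow_add. simpl. field. lra.
    + intros m Hm. assert (0 < INR m) by (apply INR_gt0; lia).
      destruct (Nat.eq_dec m n) as [->|Hd].
      * rewrite Rminus_diag, Rinv_0. field. lra.
      * assert (INR n <> INR m) by (intros E; apply INR_eq in E; lia). field. lra.
Qed.

Lemma inv_pow_le_inv n q : (1 <= n)%nat -> (1 <= q)%nat -> 0 <= (/ INR n) ^ q <= / INR n.
Proof.
  intros Hn Hq. assert (1 <= INR n) by (apply (le_INR 1); lia).
  assert (0 < / INR n) by (apply Rinv_0_lt_compat; lra).
  assert (/ INR n <= 1) by (rewrite <- Rinv_1; apply Rinv_le_contravar; lra).
  replace q with (S (q - 1)) by lia. simpl.
  assert (0 <= (/ INR n) ^ (q - 1) <= 1).
  { split; [apply pow_le; lra|]. rewrite <- (pow1 (q - 1)). apply pow_incr. lra. }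
  nra.
Qed.

Lemma is_lim_seq_psum_fin (u : nat -> nat -> R) (l : nat -> R) p :
  (forall j, (1 <= j <= p)%nat -> is_lim_seq (u j) (l j)) ->
  is_lim_seq (fun N => psum (fun j => u j N) p) (psum l p).
Proof.
  induction p as [|p IH]; intros H; simpl; [apply is_lim_seq_const|].
  apply is_lim_seq_plus'; [apply IH; intros j Hj|]; apply H; lia.
Qed.

(** Euler's formula for the double zeta value zeta(p+2, 1).  Convergence of the
    linear sum is part of the conclusion: every other term of the finite identity
    converges. *)
Lemma euler_linear_sum p :
  is_lim_seq (psum (fun n => harm (n - 1) * (/ INR n) ^ (p + 2)))
    ((INR (p + 2) * zeta (p + 3) - psum (fun j => zeta (j + 1) * zeta (p + 2 - j)) p) / 2).
Proof.
  assert (Hr : is_lim_seq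
    (fun N => psum (fun n => (/ INR n) ^ (p + 2) * (harm N - harm (N - n))) N) 0).
  { apply (is_lim_seq_convolution_bound
      (fun N n => (/ INR n) ^ (p + 2) * (harm N - harm (N - n)))).
    intros N n Hn.
    assert (HB := harm_diff_bounds (N - n) n).
    replace (N - n + n)%nat with N in HB by lia.
    replace (S (N - n)) with (S N - n)%nat in HB by lia.
    assert (HP := inv_pow_le_inv n (p + 1) ltac:(lia) ltac:(lia)).
    assert (0 < INR n) by (apply INR_gt0; lia).
    assert (0 < INR (S N - n)) by (apply INR_gt0; lia).
    replace (p + 2)%nat with (S (p + 1)) by lia. simpl pow.
    assert (0 < / INR n) by now apply Rinv_0_lt_compat.
    split.
    - apply Rmult_le_pos; [apply Rmult_le_pos|]; lra.
    - replace (/ (INR n * INR (S N - n))) with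
        ((/ INR n * / INR n) * (INR n / INR (S N - n))) by (field; lra).
      apply Rmult_le_compat; try lra; [apply Rmult_le_pos; lra|].
      apply Rmult_le_compat_l; lra. }
  assert (Hz : is_lim_seq (fun N => psum (fun j => zsum (j + 1) N * zsum (p + 2 - j) N) p)
                 (psum (fun j => zeta (j + 1) * zeta (p + 2 - j)) p)).
  { apply (is_lim_seq_psum_fin (fun j N => zsum (j + 1) N * zsum (p + 2 - j) N)
             (fun j => zeta (j + 1) * zeta (p + 2 - j))).
    intros j Hj. apply is_lim_seq_mult'; apply is_lim_seq_zsum; lia. }
  assert (Hq := is_lim_seq_zsum (p + 3) ltac:(lia)).
  apply (is_lim_seq_ext (fun N => / 2 * ((INR (p + 2) * zsum (p + 3) N
      - psum (fun j => zsum (j + 1) N * zsum (p + 2 - j) N) p)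
      - 2 * psum (fun n => (/ INR n) ^ (p + 2) * (harm N - harm (N - n))) N))).
  { intros N. rewrite euler_finite. lra. }
  replace ((INR (p + 2) * zeta (p + 3) - psum (fun j => zeta (j + 1) * zeta (p + 2 - j)) p) / 2)
    with (/ 2 * ((INR (p + 2) * zeta (p + 3)
           - psum (fun j => zeta (j + 1) * zeta (p + 2 - j)) p) - 2 * 0)) by lra.
  apply is_lim_seq_mult'; [apply is_lim_seq_const|].
  apply is_lim_seq_minus'; [apply is_lim_seq_minus'; [|exact Hz]|];
    (apply is_lim_seq_mult'; [apply is_lim_seq_const|assumption]).
Qed.

Lemma even_zeta_kernel p n m : (1 <= n)%nat -> (1 <= m)%nat ->
  psum (fun j => (/ INR n) ^ (2 * j) * (/ INR m) ^ (2 * (p + 1 - j))) p =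
  (/ INR n) ^ (2 * p) * / (INR m ^ 2 - INR n ^ 2)
  + (/ INR m) ^ (2 * p) * / (INR n ^ 2 - INR m ^ 2)
  + (if Nat.eq_dec m n then INR p * (/ INR m) ^ (2 * (p + 1)) else 0).
Proof.
  intros Hn Hm.
  assert (0 < INR n) by now apply INR_gt0.
  assert (0 < INR m) by now apply INR_gt0.
  destruct (Nat.eq_dec m n) as [->|Hd].
  - rewrite Rminus_diag, Rinv_0.
    rewrite (psum_ext _ (fun _ => (/ INR n) ^ (2 * (p + 1)) * 1)).
    + rewrite psum_scal.
      assert (E : forall q, psum (fun _ => 1) q = INR q).
      { induction q as [|q IH]; [reflexivity|]. rewrite S_INR. rewrite psum_S. lra. }
      rewrite E. ring.
    + intros j Hj. rewrite <- pow_add, Rmult_1_r. f_equal. lia.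
  - assert (INR n <> INR m) by (intros E; apply INR_eq in E; lia).
    assert (INR m ^ 2 - INR n ^ 2 <> 0) by nra.
    rewrite (psum_ext _ (fun j => ((/ INR n) ^ 2 * (/ INR m) ^ 2)
               * (((/ INR n) ^ 2) ^ (j - 1) * ((/ INR m) ^ 2) ^ (p - j)))).
    + rewrite psum_scal.
      assert (G := psum_geometric ((/ INR n) ^ 2) ((/ INR m) ^ 2) p).
      set (Q := psum _ p) in *.
      replace ((/ INR n) ^ 2 * (/ INR m) ^ 2 * Q) with
        (/ (INR m ^ 2 - INR n ^ 2) * (((/ INR n) ^ 2 - (/ INR m) ^ 2) * Q))
        by (field; repeat split; lra).
      rewrite G, !(pow_mult _ 2 p). field. split; lra.
    + intros j Hj.
      replace (2 * j)%nat with (2 + 2 * (j - 1))%nat by lia.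
      replace (2 * (p + 1 - j))%nat with (2 + 2 * (p - j))%nat by lia.
      rewrite !pow_add, !(pow_mult _ 2). ring.
Qed.

(** The same scheme as for Euler's sum, with squares of the indices; here the inner
    sum leaves no harmonic numbers in the limit. *)
Lemma even_zeta_finite p N :
  psum (fun j => zsum (2 * j) N * zsum (2 * (p + 1 - j)) N) p =
  (INR p + 3 / 2) * zsum (2 * (p + 1)) N
  - psum (fun n => (/ INR n) ^ (2 * p + 1) * (harm (N + n) - harm (N - n))) N.
Proof.
  unfold zsum at 1 2.
  rewrite (psum_ext _ (fun j => psum (fun n => psum (fun m =>
      (/ INR n) ^ (2 * j) * (/ INR m) ^ (2 * (p + 1 - j))) N) N))
    by (intros; apply psum_mult).
  rewrite psum_swap.
  rewrite (psum_ext _ (fun n => psum (fun m => psum (fun j =>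
      (/ INR n) ^ (2 * j) * (/ INR m) ^ (2 * (p + 1 - j))) p) N))
    by (intros; apply psum_swap).
  rewrite (psum_symmetrized _ (fun n m => (/ INR n) ^ (2 * p) * / (INR m ^ 2 - INR n ^ 2))
             (fun m => INR p * (/ INR m) ^ (2 * (p + 1))))
    by (intros n m Hn Hm; apply even_zeta_kernel; lia).
  rewrite psum_scal. fold (zsum (2 * (p + 1)) N).
  rewrite (psum_ext _ (fun n => 3 / 4 * (/ INR n) ^ (2 * (p + 1))
      + (- / 2) * ((/ INR n) ^ (2 * p + 1) * (harm (N + n) - harm (N - n))))).
  - rewrite !psum_plus, !psum_scal. fold (zsum (2 * (p + 1)) N). field.
  - intros n Hn. assert (0 < INR n) by (apply INR_gt0; lia).
    rewrite psum_scal.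
    rewrite (psum_ext _ (fun m => (/ 2 * / INR n) * (/ (INR m - INR n) + (-1) * / (INR m + INR n)
                + (if Nat.eq_dec m n then / (INR m + INR n) else 0)))).
    + rewrite psum_scal, !psum_plus, psum_scal, psum_inv_sub by lia.
      rewrite psum_inv_add, (psum_kronecker (fun m => / (INR m + INR n))) by lia.
      replace (harm n) with (harm (n - 1) + / INR n).
      * replace (2 * (p + 1))%nat with (2 * p + 2)%nat by lia.
        rewrite !pow_add. simpl (_ ^ 2). simpl (_ ^ 1). field. lra.
      * destruct n as [|n]; [lia|]. replace (S n - 1)%nat with n by lia. reflexivity.
    + intros m Hm. assert (0 < INR m) by (apply INR_gt0; lia).
      destruct (Nat.eq_dec m n) as [->|Hd].
      * rewrite !Rminus_diag, Rinv_0. field. lra.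
      * assert (INR n <> INR m) by (intros E; apply INR_eq in E; lia).
        assert (INR m ^ 2 - INR n ^ 2 <> 0) by nra. field. repeat split; lra.
Qed.

(** The quadratic relations between even zeta values, without Bernoulli numbers:
    the sum over m of 1 / (m^2 - n^2), without m = n, is 3 / (4 n^2). *)
Lemma even_zeta_convolution p : (1 <= p)%nat ->
  psum (fun j => zeta (2 * j) * zeta (2 * (p + 1 - j))) p =
  (INR p + 3 / 2) * zeta (2 * (p + 1)).
Proof.
  intros Hp.
  assert (Hr : is_lim_seq
    (fun N => psum (fun n =>
       / 2 * ((/ INR n) ^ (2 * p + 1) * (harm (N + n) - harm (N - n)))) N) 0).
  { apply (is_lim_seq_convolution_bound
      (fun N n => / 2 * ((/ INR n) ^ (2 * p + 1) * (harm (N + n) - harm (N - n))))).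
    intros N n Hn.
    assert (HB := harm_diff_bounds (N - n) (2 * n)).
    replace (N - n + 2 * n)%nat with (N + n)%nat in HB by lia.
    replace (S (N - n)) with (S N - n)%nat in HB by lia.
    rewrite mult_INR in HB. simpl (INR 2) in HB.
    assert (HP := inv_pow_le_inv n (2 * p) ltac:(lia) ltac:(lia)).
    assert (0 < INR n) by (apply INR_gt0; lia).
    assert (0 < INR (S N - n)) by (apply INR_gt0; lia).
    replace (2 * p + 1)%nat with (S (2 * p)) by lia. rewrite <- tech_pow_Rmult.
    assert (0 < / INR n) by now apply Rinv_0_lt_compat.
    split.
    - apply Rmult_le_pos; [lra|]. apply Rmult_le_pos; [apply Rmult_le_pos|]; lra.
    - replace (/ (INR n * INR (S N - n))) with
        (/ 2 * ((/ INR n * / INR n) * ((1 + 1) * INR n / INR (S N - n)))) by (field; lra).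
      apply Rmult_le_compat_l; [lra|].
      apply Rmult_le_compat; try lra; [apply Rmult_le_pos; lra|].
      apply Rmult_le_compat_l; lra. }
  assert (Hz : is_lim_seq (fun N => psum (fun j => zsum (2 * j) N * zsum (2 * (p + 1 - j)) N) p)
                 (psum (fun j => zeta (2 * j) * zeta (2 * (p + 1 - j))) p)).
  { apply (is_lim_seq_psum_fin (fun j N => zsum (2 * j) N * zsum (2 * (p + 1 - j)) N)
             (fun j => zeta (2 * j) * zeta (2 * (p + 1 - j)))).
    intros j Hj. apply is_lim_seq_mult'; apply is_lim_seq_zsum; lia. }
  assert (Hq := is_lim_seq_zsum (2 * (p + 1)) ltac:(lia)).
  assert (Hz' : is_lim_seq (fun N => psum (fun j => zsum (2 * j) N * zsum (2 * (p + 1 - j)) N) p)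
                  ((INR p + 3 / 2) * zeta (2 * (p + 1)) - 2 * 0)).
  { apply (is_lim_seq_ext (fun N => (INR p + 3 / 2) * zsum (2 * (p + 1)) N - 2 *
       psum (fun n => / 2 * ((/ INR n) ^ (2 * p + 1) * (harm (N + n) - harm (N - n)))) N)).
    { intros N. rewrite even_zeta_finite, psum_scal. field. }
    apply is_lim_seq_minus'; (apply is_lim_seq_mult'; [apply is_lim_seq_const|assumption]). }
  apply is_lim_seq_unique in Hz. apply is_lim_seq_unique in Hz'.
  assert (E := f_equal real (eq_trans (eq_sym Hz) Hz')). cbv [real] in E.
  rewrite E. ring.
Qed.

Lemma zeta2_sq : zeta 2 ^ 2 = 5 / 2 * zeta 4.
Proof. generalize (even_zeta_convolution 1 ltac:(lia)). simpl. lra. Qed.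

Lemma zeta2_zeta4 : zeta 2 * zeta 4 = 7 / 4 * zeta 6.
Proof. generalize (even_zeta_convolution 2 ltac:(lia)). simpl. lra. Qed.

(** The value at 1 of S_{p+1,2}, that is, the double zeta value zeta(p+2, 1). *)
Definition double_zeta (p : nat) : R :=
  Series (fun n => harm n * (/ INR (S n)) ^ (p + 2)).

Lemma double_zeta_spec p :
  is_series (fun n => harm n * (/ INR (S n)) ^ (p + 2)) (double_zeta p) /\
  double_zeta p =
    (INR (p + 2) * zeta (p + 3) - psum (fun j => zeta (j + 1) * zeta (p + 2 - j)) p) / 2.
Proof.
  assert (H := proj1 (is_lim_seq_psum_series _ _) (euler_linear_sum p)).
  assert (H' : is_series (fun n => harm n * (/ INR (S n)) ^ (p + 2))
    ((INR (p + 2) * zeta (p + 3) - psum (fun j => zeta (j + 1) * zeta (p + 2 - j)) p) / 2)).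
  { eapply is_series_ext; [|exact H]. intros n. cbv beta.
    now replace (S n - 1)%nat with n by lia. }
  assert (E := is_series_unique _ _ H'). unfold double_zeta. rewrite E. split; auto.
Qed.

Lemma double_zeta_0 : double_zeta 0 = zeta 3.
Proof. rewrite (proj2 (double_zeta_spec 0)). simpl. lra. Qed.

Lemma double_zeta_1 : double_zeta 1 = zeta 4 / 4.
Proof.
  rewrite (proj2 (double_zeta_spec 1)). generalize zeta2_sq. simpl. lra.
Qed.

Lemma double_zeta_2 : double_zeta 2 = 2 * zeta 5 - zeta 2 * zeta 3.
Proof. rewrite (proj2 (double_zeta_spec 2)). simpl. lra. Qed.

Lemma double_zeta_3 : double_zeta 3 = 3 / 4 * zeta 6 - zeta 3 ^ 2 / 2.
Proof.
  rewrite (proj2 (double_zeta_spec 3)). generalize zeta2_zeta4. simpl. lra.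
Qed.

(** * Limits *)

Lemma filterlim_Rplus {T} (F : (T -> Prop) -> Prop) {FF : Filter F} (f g : T -> R) a b :
  filterlim f F (locally a) -> filterlim g F (locally b) ->
  filterlim (fun t => f t + g t) F (locally (a + b)).
Proof.
  intros Hf Hg.
  exact (filterlim_comp_2 _ _ Rplus Hf Hg (filterlim_plus (V := R_NormedModule) a b)).
Qed.

Lemma filterlim_Rmult {T} (F : (T -> Prop) -> Prop) {FF : Filter F} (f g : T -> R) a b :
  filterlim f F (locally a) -> filterlim g F (locally b) ->
  filterlim (fun t => f t * g t) F (locally (a * b)).
Proof.
  intros Hf Hg. exact (filterlim_comp_2 _ _ Rmult Hf Hg (filterlim_mult (K := R_AbsRing) a b)).
Qed.

Lemma filterlim_Ropp {T} (F : (T -> Prop) -> Prop) {FF : Filter F} (f : T -> R) x :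
  filterlim f F (locally x) -> filterlim (fun t => - f t) F (locally (- x)).
Proof.
  intros Hf. exact (filterlim_comp _ _ _ f Ropp _ _ _ Hf (filterlim_opp (V := R_NormedModule) x)).
Qed.

Lemma filterlim_Rminus {T} (F : (T -> Prop) -> Prop) {FF : Filter F} (f g : T -> R) x y :
  filterlim f F (locally x) -> filterlim g F (locally y) ->
  filterlim (fun t => f t - g t) F (locally (x - y)).
Proof.
  intros Hf Hg. apply filterlim_Rplus; [easy|exact Hf|now apply filterlim_Ropp].
Qed.

Lemma filterlim_Rpow {T} (F : (T -> Prop) -> Prop) {FF : Filter F} (f : T -> R) a n :
  filterlim f F (locally a) -> filterlim (fun t => f t ^ n) F (locally (a ^ n)).
Proof.
  intros Hf. induction n as [|n IH]; simpl.
  - apply filterlim_const.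
  - now apply filterlim_Rmult.
Qed.

Lemma filterlim_at_right_continuous (f : R -> R) a :
  continuous f a -> filterlim f (at_right a) (locally (f a)).
Proof.
  intros H. eapply filterlim_filter_le_1; [|exact H]. apply filter_le_within.
Qed.

Lemma filterlim_at_left_continuous (f : R -> R) a :
  continuous f a -> filterlim f (at_left a) (locally (f a)).
Proof.
  intros H. eapply filterlim_filter_le_1; [|exact H]. apply filter_le_within.
Qed.

Lemma exp_pow_INR a n : exp a ^ n = exp (INR n * a).
Proof.
  induction n as [|n IH]; [simpl; now rewrite Rmult_0_l, exp_0|].
  rewrite S_INR, Rmult_plus_distr_r, Rmult_1_l, exp_plus, <- IH. simpl. ring.
Qed.

(** With s = ln t / n the product is the n-th power of n s exp s. *)
Lemma filterlim_mul_ln_pow n :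
  filterlim (fun t => t * ln t ^ n) (at_right 0) (locally 0).
Proof.
  destruct n as [|n].
  - eapply filterlim_ext; [intros t; symmetry; apply Rmult_1_r|].
    apply (filterlim_at_right_continuous (fun t => t) 0). apply continuous_id.
  - set (N := INR (S n)). assert (HN : 0 < N) by (apply INR_gt0; lia).
    assert (H : filterlim (fun t => (N * (ln t / N * exp (ln t / N))) ^ S n)
                  (at_right 0) (locally ((N * 0) ^ S n))).
    { apply filterlim_Rpow; [typeclasses eauto|].
      apply filterlim_Rmult; [typeclasses eauto|apply filterlim_const|].
      apply (filterlim_comp _ _ _ (fun t => ln t / N) (fun s => s * exp s) _
        (Rbar_locally m_infty)).
      - apply (filterlim_comp _ _ _ ln (fun s => s / N) _ (Rbar_locally m_infty)).
        + apply is_lim_ln_0.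
        + unfold Rdiv. intros P [M HM]. exists (M * N). intros y Hy. apply HM.
          apply (Rmult_lt_reg_r N); [easy|]. rewrite Rmult_assoc, Rinv_l; lra.
      - apply is_lim_mul_exp_m. }
    rewrite Rmult_0_r, pow_ne_zero in H by lia.
    eapply filterlim_ext_loc; [|exact H].
    exists (mkposreal 1 Rlt_0_1). intros t _ Ht.
    rewrite !Rpow_mult_distr.
    replace (exp (ln t / N) ^ S n) with t.
    + unfold Rdiv. rewrite Rpow_mult_distr, pow_inv. fold N.
      assert (N ^ S n <> 0) by (apply pow_nonzero; lra).
      field. easy.
    + rewrite <- (exp_ln t Ht) at 1.
      rewrite exp_pow_INR. f_equal. fold N. field. lra.
Qed.

Lemma at_right_0_intro (P : R -> Prop) : (forall t, 0 < t < 1 -> P t) -> at_right 0 P.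
Proof.
  intros H. exists (mkposreal 1 Rlt_0_1). intros t Ht Ht0. apply H. split; [easy|].
  change (Rabs (t - 0) < 1) in Ht. apply Rabs_def2 in Ht. lra.
Qed.

Lemma at_left_1_intro (P : R -> Prop) : (forall t, 0 < t < 1 -> P t) -> at_left 1 P.
Proof.
  intros H. exists (mkposreal 1 Rlt_0_1). intros t Ht Ht0. apply H. split; [|easy].
  change (Rabs (t - 1) < 1) in Ht. apply Rabs_def2 in Ht. lra.
Qed.

(** Constants of integration are always fixed at the left end of (0, +oo), where
    the functions involved are defined only as limits. *)
Lemma zero_of_derive_zero (f : R -> R) :
  (forall z, 0 < z -> is_derive f z 0) ->
  filterlim f (at_right 0) (locally 0) ->
  forall z, 0 < z -> f z = 0.
Proof.
  intros Hd Hl z Hz.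
  assert (Hc : forall t, 0 < t < z -> f t = f z).
  { intros t Ht. apply (eq_is_derive f t z); [|easy].
    intros s Hs. apply Hd. lra. }
  apply (filterlim_locally_unique (F := at_right 0) f); [|exact Hl].
  apply (filterlim_ext_loc (fun _ => f z)); [|apply filterlim_const].
  exists (mkposreal z Hz). intros t Ht Ht0. symmetry. apply Hc. split; [easy|].
  change (Rabs (t - 0) < z) in Ht. apply Rabs_def2 in Ht. lra.
Qed.

(** Abel's theorem.  With non-negative coefficients the sum at x is squeezed between
    a partial sum, which is continuous at 1, and the full sum at 1. *)
Lemma pseries_lim_at_1 (c : nat -> R) (f : R -> R) l :
  (forall n, 0 <= c n) -> is_series c l ->
  (forall x, 0 <= x < 1 -> is_pseries c x (f x)) ->
  filterlim f (at_left 1) (locally l).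
Proof.
  intros Hc Hl Hf. apply filterlim_locally. intros eps.
  assert (Hup : forall x, 0 <= x < 1 -> f x <= l).
  { intros x Hx. assert (E := is_series_unique _ _ Hl). rewrite <- E.
    assert (E' := is_pseries_unique _ _ _ (Hf x Hx)). rewrite <- E'.
    apply Series_le; [|exists l; exact Hl]. intros n.
    assert (0 <= x ^ n <= 1).
    { split; [apply pow_le; lra|]. rewrite <- (pow1 n). apply pow_incr. lra. }
    specialize (Hc n). nra. }
  assert (He : 0 < eps / 2) by (destruct eps; simpl; lra).
  assert (Hl' : is_lim_seq (sum_n c) l) by exact Hl.
  apply is_lim_seq_spec in Hl'. destruct (Hl' (mkposreal _ He)) as [N HN].
  specialize (HN N (Nat.le_refl N)). simpl in HN.
  assert (Hpart : continuous (fun x => sum_n (fun n => c n * x ^ n) N) 1).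
  { clear. induction N as [|N IH].
    - apply (continuous_ext (fun _ => c 0%nat)); [intros; rewrite sum_O; simpl; ring|].
      apply continuous_const.
    - apply (continuous_ext (fun x => sum_n (fun n => c n * x ^ n) N + c (S N) * x ^ (S N))).
      + intros. now rewrite sum_Sn.
      + apply (continuous_plus (V := R_NormedModule)); [exact IH|].
        apply continuity_pt_filterlim. reg. }
  assert (Hlow : forall x, 0 <= x < 1 -> sum_n (fun n => c n * x ^ n) N <= f x).
  { intros x Hx.
    assert (Hs : is_lim_seq (sum_n (fun n => c n * x ^ n)) (f x)).
    { eapply is_lim_seq_ext; [|exact (Hf x Hx)].
      intros n. apply sum_n_ext. intros k. rewrite pow_n_pow. unfold scal; simpl.
      unfold mult; simpl. ring. }
    apply (is_lim_seq_incr_compare _ _ Hs).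
    intros n. rewrite sum_Sn. unfold plus; simpl.
    assert (0 <= c (S n) * (x * x ^ n)); [|lra].
    apply Rmult_le_pos; [apply Hc|]. apply Rmult_le_pos; [lra|apply pow_le; lra]. }
  assert (Hloc := proj1 (filterlim_locally _ _) Hpart (mkposreal _ He)).
  assert (Hnear : at_left 1 (fun x => ball (sum_n (fun n => c n * 1 ^ n) N) (mkposreal _ He)
     (sum_n (fun n => c n * x ^ n) N))).
  { unfold at_left, within. revert Hloc. apply filter_imp. intros x Hb _. exact Hb. }
  assert (H01 : at_left 1 (fun x => 0 < x < 1)) by (apply at_left_1_intro; auto).
  generalize (filter_and _ _ Hnear H01). apply filter_imp. intros x [Hb Hx].
  change (Rabs (sum_n (fun n => c n * x ^ n) N - sum_n (fun n => c n * 1 ^ n) N) < eps / 2) in Hb.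
  rewrite (sum_n_ext (fun n => c n * 1 ^ n) c) in Hb by (intros k; now rewrite pow1, Rmult_1_r).
  change (Rabs (f x - l) < eps).
  specialize (Hup x ltac:(lra)). specialize (Hlow x ltac:(lra)).
  apply Rabs_def2 in Hb. apply Rabs_def2 in HN. apply Rabs_def1; lra.
Qed.

(** * Towers of integrals against ds / s *)

(** [tower g k] is the k-th iterated integral of s g(s) against ds/s. Its quotient
    by the variable is kept separately because it stays continuous at 0, which
    removes every singularity of ds/s. *)
Definition ravg (g : R -> R) (x : R) : R :=
  if Req_EM_T x 0 then g 0 else RInt g 0 x / x.

Fixpoint avg (k : nat) (g : R -> R) : R -> R :=
  match k with O => g | S k => ravg (avg k g) end.

Definition tower (g : R -> R) (k : nat) (x : R) : R := x * avg k g x.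

Definition cont_lt1 (g : R -> R) : Prop := forall x, x < 1 -> continuous g x.

Lemma cont_lt1_ex_RInt g a b : cont_lt1 g -> a < 1 -> b < 1 -> ex_RInt g a b.
Proof.
  intros Hg Ha Hb. apply (ex_RInt_continuous (V := R_CompleteNormedModule)).
  intros z Hz. apply Hg. unfold Rmax in Hz. destruct (Rle_dec a b); lra.
Qed.

Lemma lt1_locally x : x < 1 -> locally x (fun y => y < 1).
Proof. intros Hx. now apply open_lt. Qed.

Lemma is_derive_RInt_lt1 g x : cont_lt1 g -> x < 1 -> is_derive (RInt g 0) x (g x).
Proof.
  intros Hg Hx. apply (is_derive_RInt g (RInt g 0) 0); [|now apply Hg].
  generalize (lt1_locally x Hx). apply filter_imp. intros y Hy.
  apply (RInt_correct (V := R_CompleteNormedModule)). apply cont_lt1_ex_RInt; auto; lra.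
Qed.

Lemma mul_ravg g x : x * ravg g x = RInt g 0 x.
Proof.
  unfold ravg. destruct (Req_EM_T x 0) as [->|Hx].
  - rewrite RInt_point. unfold zero; simpl. ring.
  - field. easy.
Qed.

Lemma cont_lt1_ravg g : cont_lt1 g -> cont_lt1 (ravg g).
Proof.
  intros Hg x Hx. destruct (Req_dec x 0) as [->|Hx0].
  - assert (Hd := is_derive_RInt_lt1 g 0 Hg Rlt_0_1).
    apply is_derive_Reals in Hd.
    apply continuity_pt_filterlim. intros eps Heps.
    destruct (Hd eps Heps) as [d Hd']. exists d. split; [apply cond_pos|].
    intros y [[_ Hy] Hyd]. simpl in *. unfold R_dist in *.
    assert (y <> 0) by auto.
    rewrite Rminus_0_r in Hyd. specialize (Hd' y H Hyd).
    rewrite RInt_point in Hd'. unfold zero in Hd'; simpl in Hd'.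
    rewrite Rplus_0_l, Rminus_0_r in Hd'. unfold ravg.
    destruct (Req_EM_T y 0); [easy|]. now destruct (Req_EM_T 0 0).
  - apply (continuous_ext_loc _ (fun y => RInt g 0 y * / y)).
    + assert (Ho : locally x (fun y => y <> 0)) by now apply open_neq.
      revert Ho. apply filter_imp. intros y Hy. unfold ravg.
      destruct (Req_EM_T y 0); [easy|reflexivity].
    + apply (continuous_mult (K := R_AbsRing)).
      * apply (ex_derive_continuous (V := R_NormedModule)). exists (g x).
        now apply is_derive_RInt_lt1.
      * now apply continuous_Rinv.
Qed.

Lemma cont_lt1_avg g k : cont_lt1 g -> cont_lt1 (avg k g).
Proof. intros Hg. induction k as [|k IH]; [easy|now apply cont_lt1_ravg]. Qed.

Lemma is_derive_tower g k x : cont_lt1 g -> x < 1 -> is_derive (tower g (S k)) x (avg k g x).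
Proof.
  intros Hg Hx. apply (is_derive_ext (RInt (avg k g) 0)).
  - intros t. symmetry. apply (mul_ravg (avg k g)).
  - apply is_derive_RInt_lt1; [now apply cont_lt1_avg|easy].
Qed.

Lemma CV_radius_gt (c : nat -> R) y x :
  ex_pseries c y -> Rabs x < Rabs y -> Rbar_lt (Rabs x) (CV_radius c).
Proof.
  intros [l Hl] Hx. destruct (Rbar_lt_le_dec (Rabs x) (CV_radius c)) as [|Hle]; [easy|].
  exfalso.
  assert (Hlt : Rbar_lt (CV_radius c) (Rabs y))
    by (eapply Rbar_le_lt_trans; [exact Hle|exact Hx]).
  apply (CV_disk_outside _ _ Hlt).
  assert (Hs : ex_series (fun n => c n * y ^ n)).
  { exists l. eapply is_series_ext; [|exact Hl]. intros n. simpl.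
    rewrite pow_n_pow. unfold scal; simpl. unfold mult; simpl. ring. }
  now apply ex_series_lim_0.
Qed.

Lemma CV_radius_gt_disc (c : nat -> R) x :
  (forall y, Rabs y < 1 -> ex_pseries c y) -> Rabs x < 1 -> Rbar_lt (Rabs x) (CV_radius c).
Proof.
  intros H Hx. assert (0 <= Rabs x) by apply Rabs_pos.
  assert (E : Rabs ((Rabs x + 1) / 2) = (Rabs x + 1) / 2) by (apply Rabs_pos_eq; lra).
  apply (CV_radius_gt c ((Rabs x + 1) / 2)); [apply H|]; rewrite E; lra.
Qed.

(** Dividing the primitive by x shifts the series back, so each step of a tower
    divides the n-th coefficient by n + 1. *)
Lemma ravg_pseries (c : nat -> R) (g : R -> R) :
  (forall x, Rabs x < 1 -> is_pseries c x (g x)) ->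
  forall x, Rabs x < 1 -> is_pseries (fun n => c n / INR (S n)) x (ravg g x).
Proof.
  intros H x Hx.
  assert (Hex : forall y, Rabs y < 1 -> ex_pseries c y)
    by (intros y Hy; exists (g y); exact (H y Hy)).
  unfold ravg. destruct (Req_EM_T x 0) as [->|Hx0].
  - assert (E := is_pseries_unique _ _ _ (H 0 Hx)). rewrite PSeries_0 in E.
    replace (g 0) with (c 0%nat / INR 1) by (simpl INR; rewrite Rdiv_1_r; easy).
    apply (is_pseries_0 (fun n => c n / INR (S n))).
  - assert (Hi := is_pseries_RInt c x (CV_radius_gt_disc c x Hex Hx)).
    assert (E : RInt (PSeries c) 0 x = RInt g 0 x).
    { apply RInt_ext. intros y Hy. apply is_pseries_unique, H.
      revert Hy Hx. unfold Rmin, Rmax, Rabs.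
      destruct (Rle_dec 0 x), (Rcase_abs x), (Rcase_abs y); lra. }
    rewrite E in Hi.
    apply (is_pseries_ext (PS_decr_1 (PS_Int c))).
    { intros n. reflexivity. }
    replace (RInt g 0 x / x) with (scal (/ x) (plus (RInt g 0 x) (opp (PS_Int c 0)))).
    + apply (is_pseries_decr_1 (V := R_NormedModule)); [|easy].
      unfold mult, one; simpl. now apply Rinv_l.
    + unfold scal, plus, opp; simpl. unfold mult; simpl. field. easy.
Qed.

Lemma avg_pseries (c : nat -> R) (g : R -> R) k :
  (forall x, Rabs x < 1 -> is_pseries c x (g x)) ->
  forall x, Rabs x < 1 -> is_pseries (fun n => c n * (/ INR (S n)) ^ k) x (avg k g x).
Proof.
  intros H. induction k as [|k IH]; intros x Hx.
  - apply (is_pseries_ext c); [intros n; now rewrite pow_O, Rmult_1_r|auto].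
  - apply (is_pseries_ext (fun n => (c n * (/ INR (S n)) ^ k) / INR (S n))).
    + intros n. rewrite <- tech_pow_Rmult. unfold Rdiv.
      now rewrite Rmult_assoc, (Rmult_comm (_ ^ k)).
    + now apply ravg_pseries.
Qed.

(** * Repeated integration by parts *)

(** The hypotheses of repeated integration by parts of ln(t)^n Phi_0(t) dt/t on (0, 1].
    The main case is Phi_k(t) = F_k(x t) for a tower F; powers of t give the moments
    that are needed for Taylor coefficients. *)
Record log_tower (Phi : nat -> R -> R) : Prop := {
  log_tower_derive : forall k t, 0 < t <= 1 -> is_derive (Phi (S k)) t (Phi k t / t);
  log_tower_lim : forall k j, filterlim (fun t => ln t ^ j * Phi (S k) t) (at_right 0) (locally 0);
  log_tower_cont : forall t, 0 < t <= 1 -> continuous (Phi 0%nat) t }.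

(** The primitive of ln(t)^n Phi_k(t) / t that tends to 0 at 0+. *)
Fixpoint log_primitive (Phi : nat -> R -> R) (n k : nat) (t : R) : R :=
  match n with
  | O => Phi (S k) t
  | S m => ln t ^ S m * Phi (S k) t - INR (S m) * log_primitive Phi m (S k) t
  end.

Lemma is_derive_log_primitive Phi n k t : log_tower Phi -> 0 < t <= 1 ->
  is_derive (log_primitive Phi n k) t (ln t ^ n * (Phi k t / t)).
Proof.
  intros H Ht. revert k. induction n as [|n IH]; intros k.
  - rewrite pow_O, Rmult_1_l. now apply H.
  - assert (Hk := log_tower_derive _ H k t Ht).
    assert (Hl : is_derive (fun s => ln s ^ S n) t (INR (S n) * (/ t) * ln t ^ n)).
    { apply (is_derive_pow ln (S n)). now apply is_derive_Reals, derivable_pt_lim_ln. }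
    assert (Hm := is_derive_mult _ _ _ _ _ Hl Hk Rmult_comm).
    assert (Hs := is_derive_scal _ _ (INR (S n)) _ (IH (S k))).
    assert (Hd := is_derive_minus _ _ _ _ _ Hm Hs).
    eapply is_derive_ext; [|evar_last; [exact Hd|]].
    + intros s. reflexivity.
    + unfold minus, plus, opp, mult, scal; simpl. unfold mult; simpl. field. lra.
Qed.

Lemma log_primitive_1 Phi n k :
  log_primitive Phi n k 1 = (-1) ^ n * INR (fact n) * Phi (k + n + 1)%nat 1.
Proof.
  revert k. induction n as [|n IH]; intros k.
  - simpl. replace (k + 0 + 1)%nat with (S k) by lia. ring.
  - cbn [log_primitive]. rewrite IH, ln_1, pow_i by lia.
    rewrite fact_simpl, mult_INR.
    replace (S k + n + 1)%nat with (k + S n + 1)%nat by lia. simpl pow. ring.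
Qed.

Lemma log_primitive_lim_0 Phi n k : log_tower Phi ->
  filterlim (log_primitive Phi n k) (at_right 0) (locally 0).
Proof.
  intros H. revert k. induction n as [|n IH]; intros k.
  - eapply filterlim_ext; [|exact (log_tower_lim _ H k 0)]. intros t. simpl. ring.
  - replace (locally 0) with (locally (0 + (- INR (S n)) * 0)) by (f_equal; ring).
    eapply filterlim_ext.
    2:{ apply filterlim_Rplus; [typeclasses eauto|exact (log_tower_lim _ H k (S n))|].
        apply filterlim_Rmult; [typeclasses eauto|apply filterlim_const|exact (IH (S k))]. }
    intros t. cbn [log_primitive]. ring.
Qed.

Lemma continuous_log_integrand Phi n t : log_tower Phi -> 0 < t <= 1 ->
  continuous (fun s => ln s ^ n * (Phi 0%nat s / s)) t.
Proof.
  intros H Ht. apply (continuous_mult (K := R_AbsRing)).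
  - apply continuity_pt_filterlim. apply (continuity_pt_comp ln (fun s => s ^ n)).
    + apply derivable_continuous_pt. exists (/ t). now apply derivable_pt_lim_ln.
    + reg.
  - apply (continuous_mult (K := R_AbsRing)); [now apply H|]. apply continuous_Rinv. lra.
Qed.

Lemma is_RInt_log_tower Phi n a b : log_tower Phi -> 0 < a <= 1 -> 0 < b <= 1 ->
  is_RInt (fun s => ln s ^ n * (Phi 0%nat s / s)) a b
    (log_primitive Phi n 0 b - log_primitive Phi n 0 a).
Proof.
  intros H Ha Hb.
  assert (Hr : forall x, Rmin a b <= x <= Rmax a b -> 0 < x <= 1).
  { intros x. unfold Rmin, Rmax. destruct (Rle_dec a b); lra. }
  apply (is_RInt_derive (V := R_CompleteNormedModule)).
  - intros x Hx. now apply is_derive_log_primitive, Hr.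
  - intros x Hx. now apply continuous_log_integrand, Hr.
Qed.

Lemma log_primitive_lim_1 Phi n : log_tower Phi ->
  filterlim (log_primitive Phi n 0) (at_left 1)
    (locally ((-1) ^ n * INR (fact n) * Phi (S n) 1)).
Proof.
  intros H. replace (Phi (S n) 1) with (Phi (0 + n + 1)%nat 1) by (f_equal; lia).
  rewrite <- log_primitive_1. apply filterlim_at_left_continuous.
  apply (ex_derive_continuous (V := R_NormedModule)). eexists.
  apply is_derive_log_primitive; [easy|lra].
Qed.

(** The substitution t = u^2 turns the improper integral of ln^n t psi(t) into
    the integral of a function that is continuous on the closed unit interval. *)
Definition log_weight (n : nat) (u : R) : R :=
  (-1) ^ n / INR (fact n) * (2 * (u * ln (u ^ 2) ^ n)).

Lemma continuous_log_weight n u : continuous (log_weight n) u.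
Proof.
  apply (continuous_mult (K := R_AbsRing)); [apply continuous_const|].
  apply (continuous_mult (K := R_AbsRing)); [apply continuous_const|].
  destruct (Req_dec u 0) as [->|Hu].
  - unfold continuous. rewrite Rmult_0_l.
    assert (H := filterlim_mul_ln_pow n).
    assert (H2 : filterlim (fun t => 2 ^ n * (t * ln t ^ n)) (at_right 0) (locally (2 ^ n * 0))).
    { apply filterlim_Rmult; [typeclasses eauto|apply filterlim_const|easy]. }
    rewrite Rmult_0_r in H2.
    apply filterlim_locally. intros eps.
    destruct (proj1 (filterlim_locally _ _) H2 eps) as [d Hd].
    exists d. intros y Hy. change (Rabs (y - 0) < d) in Hy. rewrite Rminus_0_r in Hy.
    change (Rabs (y * ln (y ^ 2) ^ n - 0) < eps). rewrite Rminus_0_r.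
    destruct (Req_dec y 0) as [->|Hy0].
    + rewrite Rmult_0_l, Rabs_R0. apply cond_pos.
    + assert (Hp : 0 < Rabs y) by now apply Rabs_pos_lt.
      assert (Hb : ball 0 eps (2 ^ n * (Rabs y * ln (Rabs y) ^ n))).
      { apply Hd; [|easy]. change (Rabs (Rabs y - 0) < d). rewrite Rminus_0_r.
        now rewrite Rabs_Rabsolu. }
      change (Rabs (2 ^ n * (Rabs y * ln (Rabs y) ^ n) - 0) < eps) in Hb.
      rewrite Rminus_0_r in Hb.
      replace (y ^ 2) with (Rabs y ^ 2) by apply pow2_abs.
      rewrite ln_pow by easy. rewrite Rpow_mult_distr.
      rewrite Rabs_mult in Hb |- *. rewrite Rabs_mult in Hb. rewrite Rabs_mult.
      rewrite Rabs_Rabsolu in Hb. change (INR 2) with 2. lra.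
  - apply (continuous_mult (K := R_AbsRing)); [apply continuous_id|].
    assert (0 < u ^ 2) by nra.
    apply continuity_pt_filterlim.
    apply (continuity_pt_comp (fun y => ln (y ^ 2)) (fun s => s ^ n)); [|reg].
    apply (continuity_pt_comp (fun y => y ^ 2) ln); [reg|].
    apply derivable_continuous_pt. exists (/ u ^ 2). now apply derivable_pt_lim_ln.
Qed.

(** Both the real values of the continued polylogarithm and its Taylor coefficients
    at 0 are instances of this evaluation. *)
Lemma is_RInt_log_weight Phi psi n : log_tower Phi ->
  (forall t, 0 < t <= 1 -> Phi 0%nat t = t * psi t) ->
  (forall t, 0 <= t <= 1 -> continuous psi t) ->
  is_RInt (fun u => log_weight n u * psi (u ^ 2)) 0 1 (Phi (S n) 1).
Proof.
  intros H Hpsi Hcont.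
  set (c := (-1) ^ n / INR (fact n)).
  assert (Hfact : INR (fact n) <> 0) by apply INR_fact_neq_0.
  assert (Hsq : forall x, -1 <= x <= 1 -> 0 <= x ^ 2 <= 1) by (intros; nra).
  assert (Hc : forall x, -1 <= x <= 1 -> continuous (fun u => log_weight n u * psi (u ^ 2)) x).
  { intros x Hx. apply (continuous_mult (K := R_AbsRing)); [apply continuous_log_weight|].
    apply (continuous_comp (fun u => u ^ 2) psi); [|apply Hcont; auto].
    apply continuity_pt_filterlim. reg. }
  assert (Hex : forall a, -1 <= a <= 1 -> ex_RInt (fun u => log_weight n u * psi (u ^ 2)) a 1).
  { intros a Ha. apply (ex_RInt_continuous (V := R_CompleteNormedModule)).
    intros x. unfold Rmin, Rmax. destruct (Rle_dec a 1); [|lra]. intros Hx. apply Hc. lra. }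
  set (J := fun a : R => RInt (V := R_CompleteNormedModule)
    (fun u => log_weight n u * psi (u ^ 2)) a 1).
  assert (HJ : forall a, 0 < a < 1 ->
     J a = c * (log_primitive Phi n 0 1 - log_primitive Phi n 0 (a ^ 2))).
  { intros a Ha. apply is_RInt_unique.
    assert (Hd : forall x, 0 < x <= 1 ->
       is_derive (fun u => c * log_primitive Phi n 0 (u ^ 2)) x (log_weight n x * psi (x ^ 2))).
    { intros x Hx.
      assert (Hx2 : 0 < x ^ 2 <= 1) by nra.
      assert (Hq : is_derive (fun u => u ^ 2) x (2 * x)) by (auto_derive; [easy|ring]).
      assert (Hp := is_derive_comp _ _ _ _ _ (is_derive_log_primitive Phi n 0 _ H Hx2) Hq).
      evar_last; [exact (is_derive_scal _ _ c _ Hp)|].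
      change (c * (2 * x * (ln (x ^ 2) ^ n * (Phi 0%nat (x ^ 2) / x ^ 2))) =
        c * (2 * (x * ln (x ^ 2) ^ n)) * psi (x ^ 2)).
      rewrite Hpsi by easy. field. lra. }
    replace (c * (log_primitive Phi n 0 1 - log_primitive Phi n 0 (a ^ 2))) with
      (minus (c * log_primitive Phi n 0 (1 ^ 2)) (c * log_primitive Phi n 0 (a ^ 2)))
      by (unfold minus, plus, opp; simpl; rewrite !Rmult_1_r; ring).
    apply (is_RInt_derive (V := R_CompleteNormedModule)
      (fun u => c * log_primitive Phi n 0 (u ^ 2)));
      intros x; unfold Rmin, Rmax; destruct (Rle_dec a 1); try lra; intros Hx.
    - apply Hd. lra.
    - apply Hc. lra. }
  assert (Hlim1 : filterlim J (at_right 0) (locally (c * (log_primitive Phi n 0 1 - 0)))).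
  { apply (filterlim_ext_loc (fun a =>
      c * (log_primitive Phi n 0 1 + (-1) * log_primitive Phi n 0 (a ^ 2)))).
    { apply at_right_0_intro. intros a Ha. rewrite HJ by easy. ring. }
    replace (log_primitive Phi n 0 1 - 0) with (log_primitive Phi n 0 1 + (-1) * 0) by ring.
    apply filterlim_Rmult; [typeclasses eauto|apply filterlim_const|].
    apply filterlim_Rplus; [typeclasses eauto|apply filterlim_const|].
    apply filterlim_Rmult; [typeclasses eauto|apply filterlim_const|].
    apply (filterlim_comp _ _ _ (fun a => a ^ 2) (log_primitive Phi n 0) _ (at_right 0));
      [|now apply log_primitive_lim_0].
    intros P [d Hd].
    assert (Hm : 0 < Rmin d 1) by (apply Rmin_pos; [apply cond_pos|lra]).
    exists (mkposreal _ Hm). intros y Hy Hy0.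
    change (Rabs (y - 0) < Rmin d 1) in Hy. rewrite Rminus_0_r, Rabs_pos_eq in Hy by lra.
    assert (y < d) by (eapply Rlt_le_trans; [exact Hy|apply Rmin_l]).
    assert (y < 1) by (eapply Rlt_le_trans; [exact Hy|apply Rmin_r]).
    apply Hd; [|nra]. change (Rabs (y ^ 2 - 0) < d).
    rewrite Rminus_0_r, Rabs_pos_eq; nra. }
  assert (Hlim2 : filterlim J (at_right 0) (locally (J 0))).
  { apply (filterlim_at_right_continuous J). apply (continuous_RInt_2 (V := R_NormedModule)
      (fun u => log_weight n u * psi (u ^ 2)) 0 1).
    (* the integrand is continuous on [-1, 1], being a function of u^2 up to its weight *)
    exists (mkposreal 1 Rlt_0_1). intros a Ha.
    change (Rabs (a - 0) < 1) in Ha. apply Rabs_def2 in Ha.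
    apply (RInt_correct (V := R_CompleteNormedModule)), Hex. lra. }
  assert (E : J 0 = Phi (S n) 1).
  { rewrite (filterlim_locally_unique (F := at_right 0) _ _ _ Hlim2 Hlim1).
    rewrite log_primitive_1. replace (0 + n + 1)%nat with (S n) by lia. unfold c.
    replace ((-1) ^ n / INR (fact n) * ((-1) ^ n * INR (fact n) * Phi (S n) 1 - 0)) with
      (((-1) * (-1)) ^ n * Phi (S n) 1) by (rewrite Rpow_mult_distr; field; easy).
    replace ((-1) * (-1)) with 1 by ring.
    now rewrite pow1, Rmult_1_l. }
  rewrite <- E. apply (RInt_correct (V := R_CompleteNormedModule)), Hex. lra.
Qed.

Lemma log_tower_of_tower g x : cont_lt1 g -> x < 1 ->
  log_tower (fun k t => tower g k (x * t)).
Proof.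
  intros Hg Hx.
  assert (Hxt : forall t, 0 <= t <= 1 -> x * t < 1)
    by (intros t Ht; destruct (Rle_dec x 0); nra).
  assert (Hlin : forall t, continuous (fun s => x * s) t)
    by (intros t; apply (ex_derive_continuous (V := R_NormedModule)); auto_derive; easy).
  assert (Hc : forall k t, 0 <= t <= 1 -> continuous (fun s => avg k g (x * s)) t).
  { intros k t Ht. apply (continuous_comp (fun s => x * s) (avg k g)); [apply Hlin|].
    apply cont_lt1_avg; auto. }
  split.
  - intros k t Ht.
    assert (Hq : is_derive (fun u => x * u) t x) by (auto_derive; [easy|ring]).
    assert (Hp := is_derive_comp _ _ _ _ _ (is_derive_tower g k _ Hg (Hxt t ltac:(lra))) Hq).
    evar_last; [exact Hp|]. unfold scal; simpl. unfold mult; simpl. unfold tower. field. lra.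
  - intros k j.
    apply (filterlim_ext (fun t => (t * ln t ^ j) * (x * avg (S k) g (x * t)))).
    { intros t. unfold tower. ring. }
    replace (locally 0) with (locally (0 * (x * avg (S k) g (x * 0))))
      by (f_equal; ring).
    apply filterlim_Rmult; [typeclasses eauto|apply filterlim_mul_ln_pow|].
    apply filterlim_Rmult; [typeclasses eauto|apply filterlim_const|].
    apply (filterlim_at_right_continuous (fun t => avg (S k) g (x * t))). apply Hc. lra.
  - intros t Ht. apply (continuous_mult (K := R_AbsRing)); [apply Hlin|]. apply (Hc 0%nat). lra.
Qed.

Lemma log_tower_monomial m : log_tower (fun k t => t ^ S m * (/ INR (S m)) ^ k).
Proof.
  assert (Hm : 0 < INR (S m)) by (apply INR_gt0; lia).
  split.
  - intros k t Ht. auto_derive; [easy|].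
    change (match m with 0%nat => 1 | S _ => INR m + 1 end) with (INR (S m)).
    rewrite Nat.pred_succ || simpl pred. simpl pow. field. lra.
  - intros k j.
    apply (filterlim_ext (fun t => (t * ln t ^ j) * (t ^ m * (/ INR (S m)) ^ S k))).
    { intros t. simpl pow. ring. }
    replace (locally 0) with (locally (0 * (0 ^ m * (/ INR (S m)) ^ S k)))
      by (f_equal; apply Rmult_0_l).
    apply filterlim_Rmult; [typeclasses eauto|apply filterlim_mul_ln_pow|].
    apply (filterlim_at_right_continuous (fun t => t ^ m * (/ INR (S m)) ^ S k)).
    apply (ex_derive_continuous (V := R_NormedModule)). auto_derive. easy.
  - intros t Ht. apply (ex_derive_continuous (V := R_NormedModule)). auto_derive. easy.
Qed.

(** * Complex integrals over the unit interval *)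

(** Complex integrals are taken componentwise, which leaves only real integrals to
    handle. *)
Definition Cint (f : R -> C) : C :=
  (RInt (fun u => fst (f u)) 0 1, RInt (fun u => snd (f u)) 0 1).

Definition Ccont (f : R -> C) : Prop :=
  forall u, 0 <= u <= 1 ->
    continuous (fun v => fst (f v)) u /\ continuous (fun v => snd (f v)) u.

Lemma Ccont_real (f : R -> R) :
  (forall u, 0 <= u <= 1 -> continuous f u) -> Ccont (fun u => RtoC (f u)).
Proof. intros H u Hu. split; [now apply H|apply continuous_const]. Qed.

Lemma Ccont_const (c : C) : Ccont (fun _ => c).
Proof. intros u Hu. split; apply continuous_const. Qed.

Lemma Ccont_ext f g : (forall u, f u = g u) -> Ccont f -> Ccont g.
Proof.
  intros E H u Hu. destruct (H u Hu) as [H1 H2].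
  split; [apply (continuous_ext (fun v => fst (f v)))
         |apply (continuous_ext (fun v => snd (f v)))];
    auto; intros v; now rewrite E.
Qed.

Lemma Ccont_minus f g : Ccont f -> Ccont g -> Ccont (fun u => (f u - g u)%C).
Proof.
  intros Hf Hg u Hu. destruct (Hf u Hu), (Hg u Hu). simpl.
  split; apply (continuous_minus (V := R_NormedModule)); assumption.
Qed.

Lemma Ccont_mult f g : Ccont f -> Ccont g -> Ccont (fun u => (f u * g u)%C).
Proof.
  intros Hf Hg u Hu. destruct (Hf u Hu) as [F1 F2], (Hg u Hu) as [G1 G2]. simpl.
  split; [apply (continuous_minus (V := R_NormedModule))
         |apply (continuous_plus (V := R_NormedModule))];
  apply (continuous_mult (K := R_AbsRing)); assumption.
Qed.

Lemma Ccont_pow f n : Ccont f -> Ccont (fun u => (f u ^ n)%C).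
Proof.
  intros Hf. induction n as [|n IH].
  - exact (Ccont_const 1).
  - exact (Ccont_mult _ _ Hf IH).
Qed.

Lemma Ccont_inv f : Ccont f -> (forall u, 0 <= u <= 1 -> f u <> RtoC 0) ->
  Ccont (fun u => (/ f u)%C).
Proof.
  intros Hf Hn u Hu. destruct (Hf u Hu) as [F1 F2]. simpl.
  assert (Hd : fst (f u) * (fst (f u) * 1) + snd (f u) * (snd (f u) * 1) <> 0).
  { intros E. apply (Hn u Hu). apply injective_projections; simpl; nra. }
  assert (Hq : continuous (fun v =>
    / (fst (f v) * (fst (f v) * 1) + snd (f v) * (snd (f v) * 1))) u).
  { apply continuous_Rinv_comp; [|exact Hd].
    assert (Hsq : forall h : R -> R, continuous h u -> continuous (fun v => h v * (h v * 1)) u).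
    { intros h Hh. apply (continuous_mult (K := R_AbsRing) h); [exact Hh|].
      apply (continuous_mult (K := R_AbsRing) h); [exact Hh|apply continuous_const]. }
    exact (continuous_plus (V := R_NormedModule) _ _ _ (Hsq _ F1) (Hsq _ F2)). }
  split; apply (continuous_mult (K := R_AbsRing)); try assumption.
  now apply (continuous_opp (V := R_NormedModule)).
Qed.

Lemma unit_interval_ex_RInt (f : R -> R) :
  (forall u, 0 <= u <= 1 -> continuous f u) -> ex_RInt f 0 1.
Proof.
  intros H. apply (ex_RInt_continuous (V := R_CompleteNormedModule)).
  intros z. rewrite Rmin_left, Rmax_right by lra. apply H.
Qed.

Lemma Ccont_ex_RInt f : Ccont f ->
  ex_RInt (fun u => fst (f u)) 0 1 /\ ex_RInt (fun u => snd (f u)) 0 1.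
Proof.
  intros H. split; apply unit_interval_ex_RInt; intros u Hu;
    [exact (proj1 (H u Hu))|exact (proj2 (H u Hu))].
Qed.

Lemma Cint_ext f g : (forall u, 0 <= u <= 1 -> f u = g u) -> Cint f = Cint g.
Proof.
  intros H. unfold Cint. f_equal; apply RInt_ext; intros u;
    rewrite Rmin_left, Rmax_right by lra; intros Hu; rewrite H; auto; lra.
Qed.

Lemma RInt_Rplus (f g : R -> R) a b : ex_RInt f a b -> ex_RInt g a b ->
  RInt (fun u => f u + g u) a b = RInt f a b + RInt g a b.
Proof. exact (RInt_plus (V := R_CompleteNormedModule) f g a b). Qed.

Lemma RInt_Rminus (f g : R -> R) a b : ex_RInt f a b -> ex_RInt g a b ->
  RInt (fun u => f u - g u) a b = RInt f a b - RInt g a b.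
Proof. exact (RInt_minus (V := R_CompleteNormedModule) f g a b). Qed.

Lemma Cint_minus f g : Ccont f -> Ccont g ->
  Cint (fun u => (f u - g u)%C) = (Cint f - Cint g)%C.
Proof.
  intros Hf Hg. destruct (Ccont_ex_RInt f Hf), (Ccont_ex_RInt g Hg).
  unfold Cint, Cminus, Cplus, Copp. cbn [fst snd].
  f_equal; now apply RInt_Rminus.
Qed.

Lemma Cint_scal f c : Ccont f -> Cint (fun u => (f u * c)%C) = (Cint f * c)%C.
Proof.
  intros Hf. destruct (Ccont_ex_RInt f Hf) as [E1 E2].
  assert (S : forall (g : R -> R) a, ex_RInt g 0 1 ->
     ex_RInt (fun u => g u * a) 0 1 /\ RInt (fun u => g u * a) 0 1 = RInt g 0 1 * a).
  { intros g a Hg.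
    assert (Hs := is_RInt_scal g 0 1 a _ (RInt_correct (V := R_CompleteNormedModule) _ _ _ Hg)).
    assert (Hs' : is_RInt (fun u => g u * a) 0 1 (RInt g 0 1 * a)).
    { rewrite Rmult_comm. eapply is_RInt_ext; [|exact Hs].
      intros x _. apply Rmult_comm. }
    split; [eexists; exact Hs'|]. now apply is_RInt_unique. }
  destruct (S _ (fst c) E1), (S _ (snd c) E1), (S _ (fst c) E2), (S _ (snd c) E2).
  unfold Cint, Cmult. cbn [fst snd].
  f_equal; [rewrite RInt_Rminus by easy|rewrite RInt_Rplus by easy]; congruence.
Qed.

Lemma Cint_bound f B : Ccont f -> (forall u, 0 <= u <= 1 -> Cmod (f u) <= B) ->
  Cmod (Cint f) <= 2 * B.
Proof.
  intros Hf HB. destruct (Ccont_ex_RInt f Hf) as [E1 E2].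
  assert (H1 : Rabs (fst (Cint f)) <= B).
  { replace B with ((1 - 0) * B) by ring.
    apply (abs_RInt_le_const (fun u => fst (f u)) 0 1 B); [lra|easy|].
    intros u Hu. eapply Rle_trans; [|apply HB; exact Hu].
    eapply Rle_trans; [apply Rmax_l|apply Rmax_Cmod]. }
  assert (H2 : Rabs (snd (Cint f)) <= B).
  { replace B with ((1 - 0) * B) by ring.
    apply (abs_RInt_le_const (fun u => snd (f u)) 0 1 B); [lra|easy|].
    intros u Hu. eapply Rle_trans; [|apply HB; exact Hu].
    eapply Rle_trans; [apply Rmax_r|apply Rmax_Cmod]. }
  eapply Rle_trans; [apply Cmod_2Rmax|].
  assert (0 <= Rabs (fst (Cint f))) by apply Rabs_pos.
  assert (sqrt 2 <= 2).
  { rewrite <- (sqrt_square 2) at 2 by lra. apply sqrt_le_1_alt. lra. }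
  assert (0 <= sqrt 2) by apply sqrt_pos.
  assert (0 <= Rmax (Rabs (fst (Cint f))) (Rabs (snd (Cint f))) <= B).
  { split; [eapply Rle_trans; [|apply Rmax_l]; easy|now apply Rmax_lub]. }
  nra.
Qed.

Lemma is_series_geometric_error (a : nat -> C) (l : C) K q :
  0 <= q < 1 ->
  (forall N, Cmod (l - sum_n (G := C_AbelianMonoid) a N) <= K * q ^ N) ->
  is_series (V := C_NormedModule) a l.
Proof.
  intros Hq H.
  apply (filterlim_locally_ball_norm (K := C_AbsRing) (U := C_NormedModule)). intros eps.
  assert (Hg : is_lim_seq (fun N => K * q ^ N) 0).
  { replace (Finite 0) with (Rbar_mult K 0) by (simpl; f_equal; ring).
    apply is_lim_seq_scal_l. apply is_lim_seq_geom. rewrite Rabs_pos_eq; lra. }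
  apply is_lim_seq_spec in Hg. generalize (Hg eps). apply filter_imp. intros N HN.
  change (Cmod (sum_n (G := C_AbelianMonoid) a N - l) < eps).
  replace (sum_n (G := C_AbelianMonoid) a N - l)%C
    with (- (l - sum_n (G := C_AbelianMonoid) a N))%C by ring.
  rewrite Cmod_opp. eapply Rle_lt_trans; [apply H|].
  rewrite Rminus_0_r in HN. eapply Rle_lt_trans; [apply Rle_abs|exact HN].
Qed.

(** * The analytic continuation of the polylogarithm *)

(** Li_{n+1}(x) as the integral of (-ln t)^n / n! * x / (1 - x t) over t = u^2. *)
Definition polylog_integral (n : nat) (x : C) : C :=
  Cint (fun u => (RtoC (log_weight n u) * (x / (1 - x * RtoC (u ^ 2))))%C).

(** Taylor coefficients at x0 of x / (1 - x v). *)
Definition kernel_coeff (x0 : C) (k : nat) (v : R) : C :=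
  match k with
  | O => (x0 / (1 - x0 * RtoC v))%C
  | S j => (RtoC v ^ j * (/ (1 - x0 * RtoC v)) ^ S (S j))%C
  end.

Definition polylog_coeff (n : nat) (x0 : C) (k : nat) : C :=
  Cint (fun u => (RtoC (log_weight n u) * kernel_coeff x0 k (u ^ 2))%C).

(** The remainder is a single term, being that of a geometric series in d v / (1 - x0 v). *)
Lemma kernel_remainder x0 d v N :
  (1 - x0 * RtoC v <> 0)%C -> (1 - (x0 + d) * RtoC v <> 0)%C ->
  ((x0 + d) / (1 - (x0 + d) * RtoC v)
    - sum_n (G := C_AbelianMonoid) (fun k => kernel_coeff x0 k v * d ^ k) N)%C
  = (d ^ S N * RtoC v ^ N * (/ (1 - x0 * RtoC v)) ^ S N * / (1 - (x0 + d) * RtoC v))%C.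
Proof.
  intros H0 Hd. induction N as [|N IH].
  - rewrite sum_O. simpl. field. split; assumption.
  - rewrite sum_Sn. change (@plus C_AbelianMonoid) with Cplus.
    match goal with |- (?a - (?s + ?t))%C = _ =>
      replace (a - (s + t))%C with (a - s - t)%C by ring end.
    rewrite IH. cbn [kernel_coeff]. rewrite !Cpow_S.
    generalize (d ^ N)%C (RtoC v ^ N)%C ((/ (1 - x0 * RtoC v)) ^ N)%C. intros a b c.
    field. split; assumption.
Qed.

Lemma Ccont_log_weight n : Ccont (fun u => RtoC (log_weight n u)).
Proof. apply Ccont_real. intros u _. apply continuous_log_weight. Qed.

Lemma Ccont_sq : Ccont (fun u => RtoC (u ^ 2)).
Proof.
  apply Ccont_real. intros u _. apply (ex_derive_continuous (V := R_NormedModule)).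
  auto_derive. easy.
Qed.

Lemma sq_unit u : 0 <= u <= 1 -> 0 <= u ^ 2 <= 1.
Proof. intros; nra. Qed.

Lemma Ccont_denominator x : (forall v, 0 <= v <= 1 -> (1 - x * RtoC v <> 0)%C) ->
  Ccont (fun u => (/ (1 - x * RtoC (u ^ 2)))%C).
Proof.
  intros H. apply Ccont_inv; [|intros u Hu; now apply H, sq_unit].
  apply (Ccont_minus (fun _ => RtoC 1)); [apply Ccont_const|].
  apply (Ccont_mult (fun _ => x)); [apply Ccont_const|apply Ccont_sq].
Qed.

Lemma Ccont_kernel_coeff x0 k : (forall v, 0 <= v <= 1 -> (1 - x0 * RtoC v <> 0)%C) ->
  Ccont (fun u => kernel_coeff x0 k (u ^ 2)).
Proof.
  intros H. destruct k as [|k]; cbn [kernel_coeff].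
  - apply (Ccont_mult (fun _ => x0)); [apply Ccont_const|now apply Ccont_denominator].
  - apply (Ccont_mult (fun u => RtoC (u ^ 2) ^ k)%C
      (fun u => (/ (1 - x0 * RtoC (u ^ 2))) ^ S (S k))%C);
      apply Ccont_pow; [apply Ccont_sq|now apply Ccont_denominator].
Qed.

Lemma log_weight_bounded n : exists W, 0 <= W /\
  forall u, 0 <= u <= 1 -> Rabs (log_weight n u) <= W.
Proof.
  destruct (continuity_ab_maj (fun u => Rabs (log_weight n u)) 0 1 Rle_0_1) as [m [Hm _]].
  - intros c _. apply continuity_pt_filterlim.
    apply (continuous_comp (log_weight n) Rabs); [apply continuous_log_weight|].
    apply continuous_Rabs.
  - exists (Rabs (log_weight n m)). split; [apply Rabs_pos|exact Hm].
Qed.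

Lemma sum_n_Cint (c : nat -> R -> C) d N (w : R -> C) :
  Ccont w -> (forall k, Ccont (c k)) ->
  Ccont (fun u => w u * sum_n (G := C_AbelianMonoid) (fun k => c k u * d ^ k) N)%C /\
  Cint (fun u => w u * sum_n (G := C_AbelianMonoid) (fun k => c k u * d ^ k) N)%C
  = sum_n (G := C_AbelianMonoid) (fun k => Cint (fun u => w u * c k u) * d ^ k)%C N.
Proof.
  intros Hw Hc.
  assert (Ht : forall k, Ccont (fun u => w u * (c k u * d ^ k))%C).
  { intros k. apply (Ccont_mult w); [easy|]. apply (Ccont_mult (c k)); [easy|apply Ccont_const]. }
  assert (Et : forall k, Cint (fun u => w u * (c k u * d ^ k))%C
     = (Cint (fun u => w u * c k u) * d ^ k)%C).
  { intros k. rewrite <- Cint_scal by (apply Ccont_mult; auto).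
    apply Cint_ext. intros u _. ring. }
  induction N as [|N [IC IH]].
  - split.
    + apply (Ccont_ext (fun u => w u * (c 0%nat u * d ^ 0))%C); [|apply Ht].
      intros u. now rewrite sum_O.
    + rewrite sum_O, <- Et. apply Cint_ext. intros u _. now rewrite sum_O.
  - set (F := fun u => (w u * sum_n (G := C_AbelianMonoid) (fun k => c k u * d ^ k) N)%C) in *.
    set (G := fun u => (RtoC (-1) * (w u * (c (S N) u * d ^ S N)))%C).
    assert (HG : Ccont G)
      by (apply (Ccont_mult (fun _ => RtoC (-1))); [apply Ccont_const|apply Ht]).
    assert (E : forall u, (w u * sum_n (G := C_AbelianMonoid) (fun k => c k u * d ^ k) (S N)
                = F u - G u)%C).
    { intros u. rewrite sum_Sn. change (@plus C_AbelianMonoid) with Cplus. unfold F, G. ring. }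
    split.
    + apply (Ccont_ext (fun u => F u - G u)%C); [intros u; now rewrite E|now apply Ccont_minus].
    + rewrite (Cint_ext _ (fun u => F u - G u)%C) by auto.
      rewrite Cint_minus, IH, sum_Sn by auto. change (@plus C_AbelianMonoid) with Cplus.
      rewrite <- Et.
      replace (Cint G) with (- Cint (fun u => w u * (c (S N) u * d ^ S N)))%C; [ring|].
      rewrite (Cint_ext G (fun u => w u * (c (S N) u * d ^ S N) * RtoC (-1))%C)
        by (intros u _; unfold G; ring).
      rewrite Cint_scal by apply Ht. ring.
Qed.

(** The geometric remainder is uniform in v, so the Taylor series of the kernel
    may be integrated term by term. *)
Lemma polylog_expansion n x0 M d :
  (forall v, 0 <= v <= 1 -> (1 - x0 * RtoC v <> 0)%C /\ Cmod (/ (1 - x0 * RtoC v)) <= M) ->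
  Cmod d * M < 1 ->
  is_series (V := C_NormedModule) (fun k => polylog_coeff n x0 k * d ^ k)%C
    (polylog_integral n (x0 + d)%C).
Proof.
  intros HM Hd.
  assert (Hnz : forall v, 0 <= v <= 1 -> (1 - x0 * RtoC v <> 0)%C) by (intros v Hv; now apply HM).
  assert (HM0 : 0 < M).
  { destruct (HM 0 ltac:(lra)) as [H1 H2]. eapply Rlt_le_trans; [|exact H2].
    apply Cmod_gt_0. intros E. apply H1.
    rewrite <- (Cmult_1_r (1 - x0 * RtoC 0)), <- (Cinv_r _ H1), E. ring. }
  set (q := Cmod d * M) in *.
  assert (Hq : 0 <= q < 1) by (split; [apply Rmult_le_pos; [apply Cmod_ge_0|lra]|easy]).
  assert (Hden : forall v, 0 <= v <= 1 ->
     (1 - (x0 + d) * RtoC v <> 0)%C /\ Cmod (/ (1 - (x0 + d) * RtoC v)) <= M / (1 - q)).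
  { intros v Hv. destruct (HM v Hv) as [H1 H2].
    assert (Hlow : (1 - q) / M <= Cmod (1 - (x0 + d) * RtoC v)).
    { assert (T := Cmod_triangle (1 - (x0 + d) * RtoC v) (d * RtoC v)).
      replace (1 - (x0 + d) * RtoC v + d * RtoC v)%C with (1 - x0 * RtoC v)%C in T by ring.
      rewrite Cmod_mult, Cmod_R, (Rabs_pos_eq v) in T by lra.
      assert (Cmod d * v <= Cmod d).
      { rewrite <- (Rmult_1_r (Cmod d)) at 2. apply Rmult_le_compat_l; [apply Cmod_ge_0|lra]. }
      rewrite Cmod_inv in H2 by easy.
      assert (0 < Cmod (1 - x0 * RtoC v)) by now apply Cmod_gt_0.
      assert (/ M <= Cmod (1 - x0 * RtoC v)).
      { rewrite <- (Rinv_inv (Cmod (1 - x0 * RtoC v))).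
        apply Rinv_le_contravar; [now apply Rinv_0_lt_compat|easy]. }
      replace ((1 - q) / M) with (/ M - Cmod d) by (unfold q; field; lra). lra. }
    assert (Hpos : 0 < (1 - q) / M) by (apply Rdiv_lt_0_compat; lra).
    assert (Hnz' : (1 - (x0 + d) * RtoC v <> 0)%C) by (apply Cmod_gt_0; lra).
    split; [easy|]. rewrite Cmod_inv by easy.
    replace (M / (1 - q)) with (/ ((1 - q) / M)) by (field; lra).
    now apply Rinv_le_contravar. }
  destruct (log_weight_bounded n) as [W [HW0 HW]].
  apply (is_series_geometric_error _ _ (2 * (W * (M / (1 - q)))) q Hq).
  intros N.
  destruct (sum_n_Cint (fun k u => kernel_coeff x0 k (u ^ 2)) d N
     (fun u => RtoC (log_weight n u))) as [HC E];
    [apply Ccont_log_weight|intros k; now apply Ccont_kernel_coeff|].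
  unfold polylog_coeff. rewrite <- E. unfold polylog_integral.
  assert (HCk : Ccont (fun u =>
    RtoC (log_weight n u) * ((x0 + d) / (1 - (x0 + d) * RtoC (u ^ 2))))%C).
  { apply (Ccont_mult (fun u => RtoC (log_weight n u))); [apply Ccont_log_weight|].
    apply (Ccont_mult (fun _ => (x0 + d)%C)); [apply Ccont_const|].
    apply Ccont_denominator. intros v Hv. now apply Hden. }
  rewrite <- Cint_minus by assumption.
  rewrite Rmult_assoc. apply Cint_bound; [now apply Ccont_minus|].
  intros u Hu. assert (Hv := sq_unit u Hu). set (v := u ^ 2) in *.
  match goal with |- Cmod (?w * ?a - ?w * ?b) <= _ =>
    replace (w * a - w * b)%C with (w * (a - b))%C by ring end.
  rewrite kernel_remainder by (apply Hnz || apply Hden; easy).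
  rewrite Cmod_mult, Cmod_R, (Rmult_assoc W).
  apply Rmult_le_compat; [apply Rabs_pos|apply Cmod_ge_0|now apply HW|].
  rewrite !Cmod_mult, !Cmod_pow, Cmod_R, (Rabs_pos_eq v) by lra.
  destruct (HM v Hv) as [_ HMv]. destruct (Hden v Hv) as [_ HDv].
  replace (M / (1 - q) * q ^ N) with (q ^ N * 1 * (M / (1 - q))) by ring.
  apply Rmult_le_compat; [|apply Cmod_ge_0| |exact HDv].
  - repeat apply Rmult_le_pos; try apply pow_le; try apply Cmod_ge_0; lra.
  - rewrite Rmult_assoc, (Rmult_comm (v ^ N)), <- Rmult_assoc.
    apply Rmult_le_compat.
    + apply Rmult_le_pos; apply pow_le, Cmod_ge_0.
    + apply pow_le; lra.
    + apply Rle_trans with (q ^ S N).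
      * unfold q. rewrite Rpow_mult_distr.
        apply Rmult_le_compat_l; [apply pow_le, Cmod_ge_0|].
        apply pow_incr. split; [apply Cmod_ge_0|easy].
      * simpl. assert (0 <= q ^ N) by (apply pow_le; lra). nra.
    + rewrite <- (pow1 N). apply pow_incr. lra.
Qed.

(** At x0 = 0 the coefficients are moments of the logarithmic weight. *)
Lemma polylog_coeff_0 n k :
  polylog_coeff n 0 (S k) = RtoC ((/ INR (S k)) ^ S n).
Proof.
  assert (H := is_RInt_log_weight _ (fun t => t ^ k) n (log_tower_monomial k)).
  assert (H' : is_RInt (fun u => log_weight n u * (u ^ 2) ^ k) 0 1
    (1 ^ S k * (/ INR (S k)) ^ S n)).
  { apply H.
    - intros t Ht. simpl. ring.
    - intros t Ht. apply (ex_derive_continuous (V := R_NormedModule)). auto_derive. easy. }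
  clear H. rewrite pow1, Rmult_1_l in H'.
  unfold polylog_coeff.
  rewrite (Cint_ext _ (fun u => RtoC (log_weight n u * (u ^ 2) ^ k))).
  - unfold Cint, RtoC. cbn [fst snd]. f_equal.
    + now apply is_RInt_unique.
    + rewrite RInt_const. unfold scal; simpl. unfold mult; simpl. ring.
  - intros u Hu. cbn [kernel_coeff].
    replace (1 - 0 * RtoC (u ^ 2))%C with (RtoC 1) by ring.
    replace (/ RtoC 1)%C with (RtoC 1) by (rewrite <- RtoC_inv by lra; f_equal; lra).
    rewrite Cpow_1_l, RtoC_mult, (RtoC_pow (u ^ 2)). ring.
Qed.

(** Off the cut 1 - x0 v has no zero on [0, 1], so compactness bounds its inverse. *)
Lemma cut_plane_bound x0 : cut_plane x0 -> exists M, 0 < M /\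
  forall v, 0 <= v <= 1 -> (1 - x0 * RtoC v <> 0)%C /\ Cmod (/ (1 - x0 * RtoC v)) <= M.
Proof.
  intros Hx.
  set (Q := fun v => (1 - Re x0 * v) ^ 2 + (Im x0 * v) ^ 2).
  assert (HQ : forall v, 0 <= v <= 1 -> 0 < Q v).
  { intros v Hv. unfold Q.
    destruct (Req_dec (1 - Re x0 * v) 0) as [E1|E1]; [|nra].
    destruct (Req_dec (Im x0 * v) 0) as [E2|E2]; [|nra].
    exfalso. apply Hx. assert (v <> 0) by (intros ->; lra).
    apply Rmult_integral in E2. split; [tauto|]. nra. }
  destruct (continuity_ab_min Q 0 1 Rle_0_1) as [v0 [Hmin Hv0]].
  - intros c _. unfold Q. reg.
  - assert (Hs : 0 < sqrt (Q v0)) by now apply sqrt_lt_R0, HQ.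
    exists (/ sqrt (Q v0)). split; [now apply Rinv_0_lt_compat|].
    intros v Hv.
    assert (Hle : sqrt (Q v0) <= Cmod (1 - x0 * RtoC v)).
    { unfold Cmod. apply sqrt_le_1_alt. eapply Rle_trans; [now apply Hmin|].
      unfold Q, Re, Im. simpl. right. ring. }
    assert (Hnz : (1 - x0 * RtoC v <> 0)%C) by (apply Cmod_gt_0; lra).
    split; [easy|]. rewrite Cmod_inv by easy. now apply Rinv_le_contravar.
Qed.

(** [Li] is chosen among the functions that satisfy [is_polylog]; this exhibits one,
    so the choice is meaningful. *)
Lemma is_polylog_integral n : is_polylog (S n) (polylog_integral n).
Proof.
  split.
  - intros x Hx.
    assert (H := polylog_expansion n 0 1 x).
    rewrite Cplus_0_l in H.
    assert (H' : is_series (V := C_NormedModule) (fun k => polylog_coeff n 0 k * x ^ k)%C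
                   (polylog_integral n x)).
    { apply H; [|lra]. intros v _.
      replace (1 - 0 * RtoC v)%C with (RtoC 1) by ring.
      split; [intros E; apply RtoC_inj in E; lra|].
      rewrite Cmod_inv, Cmod_1, Rinv_1; [lra|]. intros E; apply RtoC_inj in E; lra. }
    assert (H0 : polylog_coeff n 0 0 = RtoC 0).
    { unfold polylog_coeff.
      rewrite (Cint_ext _ (fun _ => RtoC 0)).
      - unfold Cint, RtoC. cbn [fst snd]. f_equal;
          rewrite RInt_const; unfold scal; simpl; unfold mult; simpl; ring.
      - intros u _. cbn [kernel_coeff]. unfold Cdiv. ring. }
    assert (HS : is_series (V := C_NormedModule) (fun k => polylog_coeff n 0 (S k) * x ^ S k)%C
                   (polylog_integral n x)).
    { apply (is_series_incr_1 (V := C_NormedModule) (fun k => polylog_coeff n 0 k * x ^ k)%C).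
      assert (E : plus (polylog_integral n x) (polylog_coeff n 0 0 * x ^ 0)%C
        = polylog_integral n x).
      { change (polylog_integral n x + polylog_coeff n 0 0 * x ^ 0 = polylog_integral n x)%C.
        rewrite H0. ring. }
      exact (eq_ind_r (fun l => is_series (V := C_NormedModule) _ l) H' E). }
    eapply is_series_ext; [|exact HS]. intros k. cbv beta.
    match goal with |- ?a = ?b => change (@eq C a b) end.
    rewrite polylog_coeff_0.
    assert (INR (S k) <> 0) by (apply not_0_INR; lia).
    rewrite RtoC_pow, RtoC_inv by easy. rewrite Cpow_inv; [unfold Cdiv; ring|].
    intros E. apply RtoC_inj in E. easy.
  - intros x0 Hx0. destruct (cut_plane_bound x0 Hx0) as [M [HM0 HM]].
    exists (polylog_coeff n x0).
    apply (locally_le_locally_norm (V := C_NormedModule)).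
    assert (Hpos : 0 < / M) by now apply Rinv_0_lt_compat.
    exists (mkposreal _ Hpos). intros x Hx.
    change (Cmod (x - x0) < / M) in Hx.
    assert (H := polylog_expansion n x0 M (x - x0)%C HM).
    assert (E : forall a b : C, (a + (b - a))%C = b) by (intros; ring). rewrite E in H. clear E.
    eapply is_series_ext; [|apply H].
    + intros k. cbv beta.
      assert (E : pow_n (K := C_Ring) (x - x0)%C k = ((x - x0) ^ k)%C).
      { induction k as [|k IH]; [reflexivity|]. simpl. now rewrite IH. }
      change ((polylog_coeff n x0 k * (x - x0) ^ k)%C =
        (pow_n (K := C_Ring) (x - x0)%C k * polylog_coeff n x0 k)%C).
      rewrite E. apply Cmult_comm.
    + apply (Rmult_lt_reg_r (/ M)); [easy|]. rewrite Rmult_assoc, Rinv_r; lra.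
Qed.

(** * Uniqueness of the continuation on the real line *)

(** Vanishing on one side of 0 suffices: the constant coefficient is a one-sided
    limit, and dividing by the variable removes it. *)
Lemma pseries_zero_coeff (c : nat -> R) d :
  0 < d -> (forall h, 0 < h < d -> is_pseries c h 0) -> forall n, c n = 0.
Proof.
  intros Hd H n. revert c H.
  assert (Hhead : forall c, (forall h, 0 < h < d -> is_pseries c h 0) -> c 0%nat = 0).
  { intros c H.
    assert (Hr : Rbar_lt (Rabs 0) (CV_radius c)).
    { apply (CV_radius_gt c (d / 2) 0).
      - exists 0. apply H. lra.
      - rewrite Rabs_R0, Rabs_pos_eq; lra. }
    assert (Hc := PSeries_continuity c 0 Hr).
    apply continuity_pt_filterlim in Hc.
    assert (H1 := filterlim_at_right_continuous _ _ Hc).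
    rewrite PSeries_0 in H1.
    apply (filterlim_locally_unique (F := at_right 0) (PSeries c)); [exact H1|].
    apply (filterlim_ext_loc (fun _ => 0)); [|apply filterlim_const].
    exists (mkposreal d Hd). intros h Hh Hh0. symmetry. apply is_pseries_unique, H.
    change (Rabs (h - 0) < d) in Hh. apply Rabs_def2 in Hh. lra. }
  induction n as [|n IH]; intros c H; [now apply Hhead|].
  apply (IH (PS_decr_1 c)). intros h Hh.
  assert (Hy : mult (/ h) h = one) by (unfold mult, one; simpl; apply Rinv_l; lra).
  assert (E := is_pseries_decr_1 c h (/ h) 0 Hy (H h Hh)).
  replace 0 with (scal (/ h) (plus 0 (opp (c 0%nat)))); [exact E|].
  rewrite (Hhead c H). unfold scal, plus, opp; simpl. unfold mult; simpl. ring.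
Qed.

(** The identity theorem on a half-line: the leftmost point up to which p
    vanishes has a Taylor expansion that vanishes on its right side, hence
    vanishes altogether. *)
Lemma analytic_zero (p : R -> R) :
  (forall t, t < 1 -> exists c d, 0 < d /\ forall h, Rabs h < d -> is_pseries c h (p (t + h))) ->
  (forall t, Rabs t < 1 -> p t = 0) ->
  forall t, t < 1 -> p t = 0.
Proof.
  intros Han H0 t1 Ht1.
  destruct (Req_dec (p t1) 0) as [|Hne]; [easy|exfalso].
  set (E := fun r => 0 <= r /\ forall t, - r < t < 1 -> p t = 0).
  destruct (completeness E) as [r [Hub Hlub]].
  - exists (- t1). intros s [Hs Hz]. destruct (Rle_dec s (- t1)); [easy|].
    exfalso. apply Hne, Hz. lra.
  - exists 0. split; [lra|]. intros t Ht. apply H0. rewrite Rabs_pos_eq; lra.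
  - assert (Hr0 : 0 <= r).
    { apply Hub. split; [lra|]. intros t Ht. apply H0. rewrite Rabs_pos_eq; lra. }
    assert (Hz : forall t, - r < t < 1 -> p t = 0).
    { intros t Ht. destruct (Req_dec (p t) 0) as [|Hn]; [easy|exfalso].
      assert (Hb : r <= - t); [|lra]. apply Hlub. intros s [Hs Hs'].
      destruct (Rle_dec s (- t)); [easy|]. exfalso. apply Hn, Hs'. lra. }
    destruct (Han (- r) ltac:(lra)) as [c [d [Hd Hc]]].
    assert (Hm : 0 < Rmin d 1) by (apply Rmin_pos; lra).
    assert (Hm1 : Rmin d 1 <= d) by apply Rmin_l.
    assert (Hm2 : Rmin d 1 <= 1) by apply Rmin_r.
    assert (Hcz : forall n, c n = 0).
    { apply (pseries_zero_coeff c (Rmin d 1) Hm). intros h Hh.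
      rewrite <- (Hz (- r + h)) by lra. apply Hc. rewrite Rabs_pos_eq; lra. }
    assert (Hp : forall h, Rabs h < d -> p (- r + h) = 0).
    { intros h Hh. rewrite <- (is_pseries_unique _ _ _ (Hc h Hh)).
      rewrite (PSeries_ext c (fun _ => 0)) by auto.
      unfold PSeries. rewrite (Series_scal_l 0 (fun n => h ^ n)). ring. }
    assert (Hin : E (r + d / 2)).
    { split; [lra|]. intros t Ht. destruct (Rlt_dec (- r) t); [apply Hz; lra|].
      replace t with (- r + (t + r)) by ring. apply Hp. apply Rabs_def1; lra. }
    apply Hub in Hin. lra.
Qed.

Lemma sum_n_fst (a : nat -> C) n :
  fst (sum_n (G := C_AbelianMonoid) a n) = sum_n (fun k => fst (a k)) n.
Proof.
  induction n as [|n IH]; [now rewrite !sum_O|]. rewrite !sum_Sn, <- IH. reflexivity.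
Qed.

Lemma sum_n_snd (a : nat -> C) n :
  snd (sum_n (G := C_AbelianMonoid) a n) = sum_n (fun k => snd (a k)) n.
Proof.
  induction n as [|n IH]; [now rewrite !sum_O|]. rewrite !sum_Sn, <- IH. reflexivity.
Qed.

Lemma is_series_C_components (a : nat -> C) (l : C) :
  is_series (V := C_NormedModule) a l ->
  is_series (fun k => fst (a k)) (fst l) /\ is_series (fun k => snd (a k)) (snd l).
Proof.
  intros H. split.
  - apply (filterlim_ext (fun n => fst (sum_n (G := C_AbelianMonoid) a n))); [apply sum_n_fst|].
    eapply filterlim_comp; [exact H|]. apply (continuous_fst (fst l) (snd l)).
  - apply (filterlim_ext (fun n => snd (sum_n (G := C_AbelianMonoid) a n))); [apply sum_n_snd|].
    eapply filterlim_comp; [exact H|]. apply (continuous_snd (fst l) (snd l)).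
Qed.

Lemma cut_plane_real t : t < 1 -> cut_plane (RtoC t).
Proof. intros Ht [_ H]. simpl in H. lra. Qed.

Lemma analytic_at_real (f : C -> C) t : analytic_at f (RtoC t) ->
  exists a : nat -> C, exists d, 0 < d /\ forall h, Rabs h < d ->
    is_pseries (fun n => fst (a n)) h (fst (f (RtoC (t + h)))) /\
    is_pseries (fun n => snd (a n)) h (snd (f (RtoC (t + h)))).
Proof.
  intros [a [d Hd]]. exists a, d. split; [apply cond_pos|]. intros h Hh.
  assert (Hb : ball (M := C_UniformSpace) (RtoC t) d (RtoC (t + h))).
  { split; simpl.
    - change (Rabs (t + h - t) < d). now replace (t + h - t) with h by ring.
    - apply ball_center. }
  specialize (Hd _ Hb).
  assert (E : forall k, pow_n (K := C_Ring) (RtoC (t + h) - RtoC t)%C k = RtoC (h ^ k)).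
  { intros k. replace (RtoC (t + h) - RtoC t)%C with (RtoC h) by (rewrite RtoC_plus; ring).
    induction k as [|k IH]; [reflexivity|]. simpl. rewrite IH. now rewrite RtoC_mult. }
  destruct (is_series_C_components _ _ Hd) as [H1 H2].
  split; (eapply is_series_ext; [|eassumption]); intros k; cbv beta; rewrite pow_n_pow.
  - change (fst (pow_n (K := C_Ring) (RtoC (t + h) - RtoC t)%C k * a k)%C = h ^ k * fst (a k)).
    rewrite E. simpl. ring.
  - change (snd (pow_n (K := C_Ring) (RtoC (t + h) - RtoC t)%C k * a k)%C = h ^ k * snd (a k)).
    rewrite E. simpl. ring.
Qed.

(** Restricted to real points, the real and imaginary parts of the difference are
    real analytic and vanish on (-1, 1). *)
Lemma is_polylog_unique_real m f g t : is_polylog m f -> is_polylog m g -> t < 1 ->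
  f (RtoC t) = g (RtoC t).
Proof.
  intros [Fs Fa] [Gs Ga] Ht.
  assert (Hdisc : forall s, Rabs s < 1 -> f (RtoC s) = g (RtoC s)).
  { intros s Hs.
    refine (filterlim_locally_unique (K := C_AbsRing) (V := C_NormedModule)
      (F := eventually) _ _ _ (Fs _ _) (Gs _ _)); now rewrite Cmod_R. }
  assert (Hexp : forall s, s < 1 -> exists a b : nat -> C, exists d,
    0 < d /\ forall h, Rabs h < d ->
    is_pseries (fun n => fst (a n) - fst (b n)) h
      (fst (f (RtoC (s + h))) - fst (g (RtoC (s + h)))) /\
    is_pseries (fun n => snd (a n) - snd (b n)) h
      (snd (f (RtoC (s + h))) - snd (g (RtoC (s + h))))).
  { intros s Hs.
    destruct (analytic_at_real f s (Fa _ (cut_plane_real s Hs))) as [a [d [Hd Ha]]].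
    destruct (analytic_at_real g s (Ga _ (cut_plane_real s Hs))) as [b [e [He Hb]]].
    exists a, b, (Rmin d e). split; [now apply Rmin_pos|]. intros h Hh.
    destruct (Ha h) as [A1 A2]; [eapply Rlt_le_trans; [exact Hh|apply Rmin_l]|].
    destruct (Hb h) as [B1 B2]; [eapply Rlt_le_trans; [exact Hh|apply Rmin_r]|].
    split.
    - exact (is_pseries_minus _ _ _ _ _ A1 B1).
    - exact (is_pseries_minus _ _ _ _ _ A2 B2). }
  apply injective_projections.
  - apply Rminus_diag_uniq.
    apply (analytic_zero (fun s => fst (f (RtoC s)) - fst (g (RtoC s)))); [|intros s Hs|easy].
    + intros s Hs. destruct (Hexp s Hs) as [a [b [d [Hd H]]]].
      exists (fun n => fst (a n) - fst (b n)), d. split; [easy|].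
      intros h Hh. exact (proj1 (H h Hh)).
    + rewrite Hdisc by easy. ring.
  - apply Rminus_diag_uniq.
    apply (analytic_zero (fun s => snd (f (RtoC s)) - snd (g (RtoC s)))); [|intros s Hs|easy].
    + intros s Hs. destruct (Hexp s Hs) as [a [b [d [Hd H]]]].
      exists (fun n => snd (a n) - snd (b n)), d. split; [easy|].
      intros h Hh. exact (proj2 (H h Hh)).
    + rewrite Hdisc by easy. ring.
Qed.

(** * Real polylogarithms and Nielsen polylogarithms *)

Definition inv1m (x : R) : R := / (1 - x).

Definition li (m : nat) : R -> R := tower inv1m m.

Lemma cont_inv1m : cont_lt1 inv1m.
Proof.
  intros x Hx. apply (ex_derive_continuous (V := R_NormedModule)). unfold inv1m.
  auto_derive. lra.
Qed.

Lemma Li_real n x : x < 1 -> Li (S n) (RtoC x) = RtoC (li (S n) x).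
Proof.
  intros Hx.
  assert (HLi : is_polylog (S n) (Li (S n))).
  { unfold Li. apply epsilon_spec. exists (polylog_integral n). apply is_polylog_integral. }
  rewrite (is_polylog_unique_real _ _ _ x HLi (is_polylog_integral n) Hx).
  assert (Hxt : forall t, 0 <= t <= 1 -> x * t < 1)
    by (intros t Ht; destruct (Rle_dec x 0); nra).
  assert (H : is_RInt (fun u => log_weight n u * (x / (1 - x * u ^ 2))) 0 1
                (tower inv1m (S n) (x * 1))).
  { apply (is_RInt_log_weight (fun k t => tower inv1m k (x * t)) (fun t => x / (1 - x * t)) n).
    - apply log_tower_of_tower; [apply cont_inv1m|easy].
    - intros t Ht. specialize (Hxt t ltac:(lra)). unfold tower, inv1m. simpl. field. lra.
    - intros t Ht. specialize (Hxt t Ht). apply (ex_derive_continuous (V := R_NormedModule)).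
      auto_derive. lra. }
  rewrite Rmult_1_r in H.
  unfold polylog_integral.
  rewrite (Cint_ext _ (fun u => RtoC (log_weight n u * (x / (1 - x * u ^ 2))))).
  - unfold Cint, RtoC. cbn [fst snd]. f_equal; [now apply is_RInt_unique|].
    rewrite RInt_const. unfold scal; simpl. unfold mult; simpl. ring.
  - intros u Hu. specialize (Hxt (u ^ 2) (sq_unit u Hu)).
    rewrite RtoC_mult, RtoC_div, RtoC_minus, RtoC_mult by lra. reflexivity.
Qed.

(** The derivative of ln(1 - x)^2 / 2, and the generating function of the harmonic
    numbers. *)
Definition log_kernel (x : R) : R := - ln (1 - x) / (1 - x).

(** [nielsen2 k] is S_{k,2}; at level 0 it is ln(1 - x)^2 / 2. *)
Definition nielsen2 (k : nat) : R -> R := tower (ravg log_kernel) k.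

Lemma cont_log_kernel : cont_lt1 log_kernel.
Proof.
  intros x Hx. apply (ex_derive_continuous (V := R_NormedModule)). unfold log_kernel.
  auto_derive. repeat split; lra.
Qed.

Lemma nielsen2_0 x : x < 1 -> nielsen2 0 x = ln (1 - x) ^ 2 / 2.
Proof.
  intros Hx. unfold nielsen2, tower. simpl avg. rewrite mul_ravg.
  apply is_RInt_unique.
  replace (ln (1 - x) ^ 2 / 2) with (minus (ln (1 - x) ^ 2 / 2) (ln (1 - 0) ^ 2 / 2)).
  2:{ rewrite Rminus_0_r, ln_1. unfold minus, plus, opp; simpl. field. }
  apply (is_RInt_derive (V := R_CompleteNormedModule) (fun y => ln (1 - y) ^ 2 / 2)).
  - intros y Hy. assert (y < 1) by (revert Hy; unfold Rmax; destruct (Rle_dec 0 x); lra).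
    unfold log_kernel. auto_derive; [lra|]. fold (1 - y). field. lra.
  - intros y Hy. apply cont_log_kernel. revert Hy; unfold Rmax; destruct (Rle_dec 0 x); lra.
Qed.

Lemma is_RInt_gen_log_tower Phi n : log_tower Phi ->
  is_RInt_gen (fun t => ln t ^ n * (Phi 0%nat t / t)) (at_right 0) (at_left 1)
    ((-1) ^ n * INR (fact n) * Phi (S n) 1).
Proof.
  intros H P HP.
  assert (L : filterlim (fun ab : R * R => log_primitive Phi n 0 (snd ab)
                + (-1) * log_primitive Phi n 0 (fst ab)) (filter_prod (at_right 0) (at_left 1))
      (locally ((-1) ^ n * INR (fact n) * Phi (S n) 1 + (-1) * 0))).
  { apply filterlim_Rplus; [typeclasses eauto| |].
    - eapply filterlim_comp; [apply filterlim_snd|now apply log_primitive_lim_1].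
    - apply filterlim_Rmult; [typeclasses eauto|apply filterlim_const|].
      eapply filterlim_comp; [apply filterlim_fst|now apply log_primitive_lim_0]. }
  rewrite Rmult_0_r, Rplus_0_r in L.
  assert (H01 : filter_prod (at_right 0) (at_left 1)
     (fun ab : R * R => 0 < fst ab < 1 /\ 0 < snd ab < 1)).
  { apply (Filter_prod _ _ _ (fun a => 0 < a < 1) (fun b => 0 < b < 1));
      [now apply at_right_0_intro|now apply at_left_1_intro|auto]. }
  assert (LP := L P HP). unfold filtermap in LP.
  unfold filtermapi. generalize (filter_and _ _ LP H01). apply filter_imp.
  intros [a b] [Hab [Ha Hb]]. simpl in *.
  exists (log_primitive Phi n 0 b - log_primitive Phi n 0 a). split.
  - apply is_RInt_log_tower; [easy|lra|lra].
  - now replace (log_primitive Phi n 0 b - log_primitive Phi n 0 a) with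
      (log_primitive Phi n 0 b + (-1) * log_primitive Phi n 0 a) by ring.
Qed.

Lemma is_RInt_gen_RtoC (f : R -> R) Fa Fb {FFa : Filter Fa} {FFb : Filter Fb} (l : R) :
  is_RInt_gen f Fa Fb l ->
  is_RInt_gen (V := C_R_NormedModule) (fun t => RtoC (f t)) Fa Fb (RtoC l).
Proof.
  intros H P [e HP].
  assert (Hl : locally l (fun y => P (RtoC y))).
  { exists e. intros y Hy. apply HP. split; [exact Hy|apply ball_center]. }
  assert (HF := H _ Hl). unfold filtermapi in *. revert HF. apply filter_imp.
  intros ab [y [Hy HPy]].
  exists (RtoC y). split; [|exact HPy].
  apply (is_RInt_fct_extend_pair (U := R_NormedModule) (V := R_NormedModule)); [exact Hy|].
  evar_last; [exact (is_RInt_const (V := R_NormedModule) (fst ab) (snd ab) 0)|].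
  unfold scal; simpl. unfold mult; simpl. apply Rmult_0_r.
Qed.

Lemma Clog_pos r : 0 < r -> Clog (RtoC r) = RtoC (ln r).
Proof.
  intros Hr. unfold Clog, Carg, RtoC. simpl.
  destruct (Rle_dec 0 0) as [_|n]; [|lra].
  fold (RtoC r). rewrite Cmod_R, Rabs_pos_eq by lra.
  replace (r / r) with 1 by (field; lra). now rewrite acos_1.
Qed.

(** For real x < 1 the logarithm in the integrand is real, and integration by parts
    climbs from ln(1 - x t)^2 / 2 to level n + 1 of the tower. *)
Lemma nielsen_real n x : x < 1 -> nielsen (S n) 2 (RtoC x) = RtoC (nielsen2 (S n) x).
Proof.
  intros Hx. unfold nielsen.
  replace (S n - 1)%nat with n by lia.
  replace (S n + 2 - 1)%nat with (S (S n)) by lia.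
  assert (Hxt : forall t, 0 <= t <= 1 -> x * t < 1)
    by (intros t Ht; destruct (Rle_dec x 0); nra).
  assert (HT : log_tower (fun k t => tower (ravg log_kernel) k (x * t))).
  { apply log_tower_of_tower; [apply cont_lt1_ravg, cont_log_kernel|easy]. }
  assert (H := is_RInt_gen_scal _ 2 _ (is_RInt_gen_log_tower _ n HT)).
  cbv beta in H. rewrite Rmult_1_r in H.
  apply is_RInt_gen_RtoC in H; [|typeclasses eauto|typeclasses eauto].
  assert (HG : is_RInt_gen (V := C_R_NormedModule)
     (fun t : R => (RtoC (ln t) ^ n * Clog (RtoC 1 - RtoC x * RtoC t) ^ 2 / RtoC t)%C)
     (at_right 0) (at_left 1)
     (RtoC (2 * ((-1) ^ n * INR (fact n) * nielsen2 (S n) x)))).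
  { refine (is_RInt_gen_ext _ _ _ _ H).
    apply (Filter_prod _ _ _ (fun a => 0 < a < 1) (fun b => 0 < b < 1));
      [now apply at_right_0_intro|now apply at_left_1_intro|].
    intros a b Ha Hb t Ht. simpl in Ht.
    assert (H01 : 0 < t < 1) by (revert Ht; unfold Rmin, Rmax; destruct (Rle_dec a b); lra).
    specialize (Hxt t ltac:(lra)).
    replace (RtoC 1 - RtoC x * RtoC t)%C with (RtoC (1 - x * t))
      by (rewrite RtoC_minus, RtoC_mult; reflexivity).
    rewrite Clog_pos by lra. rewrite <- !RtoC_pow, <- RtoC_mult, <- RtoC_div by lra.
    f_equal. match goal with |- scal 2 ?a = ?b => change (2 * a = b) end.
    fold (nielsen2 0 (x * t)). rewrite nielsen2_0 by easy. field. lra. }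
  rewrite (is_RInt_gen_unique (V := C_R_CompleteNormedModule) _ _ HG).
  rewrite <- RtoC_mult. f_equal.
  assert (INR (fact n) <> 0) by apply INR_fact_neq_0.
  change (INR (fact 2)) with 2.
  replace ((-1) ^ S (S n)) with ((-1) ^ n) by (simpl; ring).
  transitivity (((-1) * (-1)) ^ n * nielsen2 (S n) x).
  - rewrite Rpow_mult_distr. field. easy.
  - replace ((-1) * (-1)) with 1 by ring. rewrite pow1. ring.
Qed.

(** * Boundary values *)

Lemma li_1 x : x < 1 -> li 1 x = - ln (1 - x).
Proof.
  intros Hx. unfold li, tower. simpl avg. rewrite mul_ravg.
  apply is_RInt_unique.
  replace (- ln (1 - x)) with (minus (- ln (1 - x)) (- ln (1 - 0))).
  2:{ rewrite Rminus_0_r, ln_1. unfold minus, plus, opp; simpl. ring. }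
  apply (is_RInt_derive (V := R_CompleteNormedModule) (fun y => - ln (1 - y))).
  - intros y Hy. assert (y < 1) by (revert Hy; unfold Rmax; destruct (Rle_dec 0 x); lra).
    unfold inv1m. auto_derive; [lra|]. fold (1 - y). field. lra.
  - intros y Hy. apply cont_inv1m. revert Hy; unfold Rmax; destruct (Rle_dec 0 x); lra.
Qed.

Lemma inv1m_pseries x : Rabs x < 1 -> is_pseries (fun _ => 1) x (inv1m x).
Proof.
  intros Hx. eapply is_series_ext; [|exact (is_series_geom x Hx)].
  intros n. cbv beta. rewrite <- pow_n_pow. symmetry. apply Rmult_1_r.
Qed.

(** The product of the series of - ln(1 - x) and 1 / (1 - x). *)
Lemma log_kernel_pseries x : Rabs x < 1 -> is_pseries harm x (log_kernel x).
Proof.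
  intros Hx.
  assert (Hx1 : x < 1) by (apply Rabs_def2 in Hx; lra).
  assert (Hex : forall y, Rabs y < 1 -> ex_pseries (fun n => / INR n) y).
  { intros y Hy.
    assert (H := avg_pseries _ _ 1 inv1m_pseries y Hy).
    apply (is_pseries_incr_1 (V := R_NormedModule)) in H.
    eexists. eapply is_pseries_ext; [|exact H].
    intros [|n]; unfold PS_incr_1.
    - simpl INR. now rewrite Rinv_0.
    - rewrite pow_1. apply Rmult_1_l. }
  assert (Hl : is_pseries (fun n => / INR n) x (- ln (1 - x))).
  { assert (H := avg_pseries _ _ 1 inv1m_pseries x Hx).
    apply (is_pseries_incr_1 (V := R_NormedModule)) in H.
    rewrite <- li_1 by easy.
    eapply is_pseries_ext; [|exact H].
    intros [|n]; unfold PS_incr_1.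
    - simpl INR. now rewrite Rinv_0.
    - rewrite pow_1. apply Rmult_1_l. }
  assert (H := is_pseries_mult _ _ x _ _ Hl (inv1m_pseries x Hx)
    (CV_radius_gt_disc _ _ Hex Hx)
    (CV_radius_gt_disc _ _ (fun y Hy => ex_intro _ _ (inv1m_pseries y Hy)) Hx)).
  eapply is_pseries_ext; [|exact H].
  intros n. unfold PS_mult. match goal with |- ?p = ?q => change (@eq R p q) end.
  induction n as [|n IH].
  - simpl. rewrite Rinv_0. unfold harm. simpl. ring.
  - rewrite tech5, IH. change (harm (S n)) with (harm n + / INR (S n)). ring.
Qed.

Lemma tower_lim_at_1 c (g : R -> R) k l :
  (forall n, 0 <= c n) ->
  (forall x, Rabs x < 1 -> is_pseries c x (g x)) ->
  is_series (fun n => c n * (/ INR (S n)) ^ k) l ->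
  filterlim (tower g k) (at_left 1) (locally l).
Proof.
  intros Hc Hg Hl. rewrite <- (Rmult_1_l l).
  apply filterlim_Rmult; [typeclasses eauto| |].
  - apply (filterlim_at_left_continuous (fun x => x)). apply continuous_id.
  - apply (pseries_lim_at_1 (fun n => c n * (/ INR (S n)) ^ k)); [|easy|].
    + intros n. apply Rmult_le_pos; [apply Hc|]. apply pow_le. left.
      apply Rinv_0_lt_compat, INR_gt0. lia.
    + intros x Hx. apply avg_pseries; [exact Hg|]. rewrite Rabs_pos_eq; lra.
Qed.

Lemma zeta_series s : (2 <= s)%nat -> is_series (fun n => (/ INR (S n)) ^ s) (zeta s).
Proof. intros Hs. exact (proj1 (is_lim_seq_psum_series _ _) (is_lim_seq_zsum s Hs)). Qed.

Lemma li_lim_at_1 k : (2 <= k)%nat -> filterlim (li k) (at_left 1) (locally (zeta k)).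
Proof.
  intros Hk. apply (tower_lim_at_1 (fun _ => 1)); [intros; lra|exact inv1m_pseries|].
  eapply is_series_ext; [|exact (zeta_series k Hk)]. intros n. symmetry. apply Rmult_1_l.
Qed.

Lemma harm_nonneg n : 0 <= harm n.
Proof.
  apply psum_nonneg. intros k Hk. left. apply Rinv_0_lt_compat, INR_gt0. lia.
Qed.

Lemma nielsen2_lim_at_1 p :
  filterlim (nielsen2 (S p)) (at_left 1) (locally (double_zeta p)).
Proof.
  apply (tower_lim_at_1 (fun n => harm n / INR (S n))).
  - intros n. apply Rmult_le_pos; [apply harm_nonneg|].
    left. apply Rinv_0_lt_compat, INR_gt0. lia.
  - intros x Hx. apply ravg_pseries; [exact log_kernel_pseries|exact Hx].
  - eapply is_series_ext; [|exact (proj1 (double_zeta_spec p))].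
    intros n. cbv beta. replace (p + 2)%nat with (S (S p)) by lia.
    rewrite <- tech_pow_Rmult. unfold Rdiv. symmetry. apply Rmult_assoc.
Qed.

(** A Lipschitz bound at 1, from 1 - x^n <= n (1 - x) in each term. *)
Lemma li_near_1 k x : (2 <= k)%nat -> 0 <= x < 1 ->
  Rabs (li (S k) x - zeta (S k)) <= (1 - x) * zeta k.
Proof.
  intros Hk Hx.
  assert (Ha : Rabs x < 1) by (rewrite Rabs_pos_eq; lra).
  assert (Hs : is_series (fun n => (/ INR (S n)) ^ S k * x ^ S n) (li (S k) x)).
  { assert (H := avg_pseries _ _ (S k) inv1m_pseries x Ha).
    apply (is_series_scal x) in H.
    eapply is_series_ext; [|exact H].
    intros n. cbv beta. rewrite pow_n_pow.
    match goal with |- scal x (scal (x ^ n) (1 * ?q)) = _ =>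
      change (x * (x ^ n * (1 * q)) = q * (x * x ^ n)) end. ring. }
  assert (Hd := is_series_minus _ _ _ _ (zeta_series (S k) ltac:(lia)) Hs).
  assert (Hb := is_series_scal (1 - x) _ _ (zeta_series k Hk)).
  assert (Hpow : forall n, 0 <= x ^ n <= 1).
  { intros n. split; [apply pow_le; lra|]. rewrite <- (pow1 n). apply pow_incr. lra. }
  assert (Hbern : forall n, 1 - x ^ n <= INR n * (1 - x)).
  { induction n as [|n IH]; [simpl; lra|]. rewrite S_INR. simpl pow. specialize (Hpow n). nra. }
  assert (Hterm : forall n,
     0 <= (/ INR (S n)) ^ S k - (/ INR (S n)) ^ S k * x ^ S n <= (1 - x) * (/ INR (S n)) ^ k).
  { intros n. assert (Hn : 0 < INR (S n)) by (apply INR_gt0; lia).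
    assert (0 <= (/ INR (S n)) ^ k) by (apply pow_le; left; now apply Rinv_0_lt_compat).
    assert (0 < / INR (S n)) by now apply Rinv_0_lt_compat.
    specialize (Hpow (S n)). specialize (Hbern (S n)).
    assert (E : (/ INR (S n)) ^ S k - (/ INR (S n)) ^ S k * x ^ S n
       = (/ INR (S n)) ^ k * (/ INR (S n) * (1 - x ^ S n))).
    { rewrite <- tech_pow_Rmult. ring. }
    rewrite E. split.
    - apply Rmult_le_pos; [easy|]. apply Rmult_le_pos; lra.
    - rewrite (Rmult_comm (1 - x)). apply Rmult_le_compat_l; [easy|].
      apply (Rmult_le_reg_l (INR (S n))); [easy|].
      rewrite <- Rmult_assoc, Rinv_r, Rmult_1_l by lra. exact Hbern. }
  set (t := fun n => (/ INR (S n)) ^ S k - (/ INR (S n)) ^ S k * x ^ S n) in *.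
  assert (U : Series t = zeta (S k) - li (S k) x) by exact (is_series_unique _ _ Hd).
  assert (V : Series (fun n => (1 - x) * (/ INR (S n)) ^ k) = (1 - x) * zeta k)
    by exact (is_series_unique _ _ Hb).
  assert (Hle : Series t <= (1 - x) * zeta k).
  { rewrite <- V. apply Series_le; [exact Hterm|eexists; exact Hb]. }
  assert (Hge : 0 <= Series t).
  { rewrite <- (Rmult_0_l (Series (fun _ => 0))), <- Series_scal_l.
    apply Series_le; [|eexists; exact Hd].
    intros n. rewrite Rmult_0_l. split; [lra|apply Hterm]. }
  rewrite Rabs_minus_sym, Rabs_pos_eq; lra.
Qed.

(** * The three arguments as functions of z *)

(** This is coth z + 1, the logarithmic derivative of e^{2z} - 1; the logarithmic
    derivatives of 1 - e^{-2z} and e^{-2z} are [wz z - 2] and -2. *)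
Definition wz (z : R) : R := 2 / (1 - exp (- (2 * z))).
Definition Lz (z : R) : R := ln (2 * sinh z).

(** As z tends to 0+ the arguments 1 - e^{2z} and 1 - e^{-2z} tend to 0, and e^{-2z}
    tends to 1. *)
Definition at_far (T : nat -> R -> R) (k : nat) (z : R) : R := T k (1 - exp (2 * z)).
Definition at_mid (T : nat -> R -> R) (k : nat) (z : R) : R := T k (1 - exp (- (2 * z))).
Definition at_exp (T : nat -> R -> R) (k : nat) (z : R) : R := T k (exp (- (2 * z))).

Lemma args_lt_1 z : 0 < z ->
  1 - exp (2 * z) < 0 /\ 0 < exp (- (2 * z)) < 1.
Proof.
  intros Hz. assert (H1 := exp_increasing 0 (2 * z) ltac:(lra)).
  assert (H2 := exp_increasing (- (2 * z)) 0 ltac:(lra)).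
  assert (H3 := exp_pos (- (2 * z))). rewrite exp_0 in *. lra.
Qed.

Lemma exp_2z_inv z : exp (2 * z) = / exp (- (2 * z)).
Proof. rewrite <- exp_Ropp. f_equal. ring. Qed.

Lemma is_derive_at_far g k z : cont_lt1 g -> 0 < z ->
  is_derive (at_far (tower g) (S k)) z (wz z * at_far (tower g) k z).
Proof.
  intros Hg Hz. destruct (args_lt_1 z Hz) as [H1 H2].
  assert (Hq : is_derive (fun u => 1 - exp (2 * u)) z (- (2 * exp (2 * z))))
    by (auto_derive; [easy|ring]).
  evar_last; [exact (is_derive_comp _ (fun u => 1 - exp (2 * u)) _ _ _
    (is_derive_tower g k (1 - exp (2 * z)) Hg ltac:(lra)) Hq)|].
  match goal with |- scal ?a ?b = ?c => change (a * b = c) end.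
  unfold at_far, tower, wz. rewrite exp_2z_inv in *. field. lra.
Qed.

Lemma is_derive_at_mid g k z : cont_lt1 g -> 0 < z ->
  is_derive (at_mid (tower g) (S k)) z ((wz z - 2) * at_mid (tower g) k z).
Proof.
  intros Hg Hz. destruct (args_lt_1 z Hz) as [H1 H2].
  assert (Hq : is_derive (fun u => 1 - exp (- (2 * u))) z (2 * exp (- (2 * z))))
    by (auto_derive; [easy|ring]).
  evar_last; [exact (is_derive_comp _ (fun u => 1 - exp (- (2 * u))) _ _ _
    (is_derive_tower g k (1 - exp (- (2 * z))) Hg ltac:(lra)) Hq)|].
  match goal with |- scal ?a ?b = ?c => change (a * b = c) end.
  unfold at_mid, tower, wz. field. lra.
Qed.

Lemma is_derive_at_exp g k z : cont_lt1 g -> 0 < z ->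
  is_derive (at_exp (tower g) (S k)) z (-2 * at_exp (tower g) k z).
Proof.
  intros Hg Hz. destruct (args_lt_1 z Hz) as [H1 H2].
  assert (Hq : is_derive (fun u => exp (- (2 * u))) z (-2 * exp (- (2 * z))))
    by (auto_derive; [easy|ring]).
  evar_last; [exact (is_derive_comp _ (fun u => exp (- (2 * u))) _ _ _
    (is_derive_tower g k (exp (- (2 * z))) Hg ltac:(lra)) Hq)|].
  match goal with |- scal ?a ?b = ?c => change (a * b = c) end.
  unfold at_exp, tower. ring.
Qed.

Lemma at_far_lim g k : cont_lt1 g ->
  filterlim (at_far (tower g) k) (at_right 0) (locally 0).
Proof.
  intros Hg.
  assert (Hc : continuous (at_far (tower g) k) 0).
  { unfold at_far. apply (continuous_comp (fun z => 1 - exp (2 * z)) (tower g k)).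
    - apply (ex_derive_continuous (V := R_NormedModule)). auto_derive. easy.
    - apply (continuous_mult (K := R_AbsRing)); [apply continuous_id|].
      apply cont_lt1_avg; [easy|]. rewrite Rmult_0_r, exp_0. lra. }
  apply filterlim_at_right_continuous in Hc.
  replace (at_far (tower g) k 0) with 0 in Hc; [exact Hc|].
  unfold at_far, tower. rewrite Rmult_0_r, exp_0. ring.
Qed.

Lemma at_mid_lim g k : cont_lt1 g ->
  filterlim (at_mid (tower g) k) (at_right 0) (locally 0).
Proof.
  intros Hg.
  assert (Hc : continuous (at_mid (tower g) k) 0).
  { unfold at_mid. apply (continuous_comp (fun z => 1 - exp (- (2 * z))) (tower g k)).
    - apply (ex_derive_continuous (V := R_NormedModule)). auto_derive. easy.
    - apply (continuous_mult (K := R_AbsRing)); [apply continuous_id|].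
      apply cont_lt1_avg; [easy|]. rewrite Rmult_0_r, Ropp_0, exp_0. lra. }
  apply filterlim_at_right_continuous in Hc.
  replace (at_mid (tower g) k 0) with 0 in Hc; [exact Hc|].
  unfold at_mid, tower. rewrite Rmult_0_r, Ropp_0, exp_0. ring.
Qed.

Lemma exp_m2z_at_left : filterlim (fun z => exp (- (2 * z))) (at_right 0) (at_left 1).
Proof.
  assert (Hc : continuous (fun z => exp (- (2 * z))) 0).
  { apply (ex_derive_continuous (V := R_NormedModule)). auto_derive. easy. }
  apply filterlim_at_right_continuous in Hc. rewrite Rmult_0_r, Ropp_0, exp_0 in Hc.
  intros P HP. unfold at_left, within in HP. apply Hc in HP. unfold filtermap in *.
  assert (H0 : at_right 0 (fun z => 0 < z < 1)) by (apply at_right_0_intro; auto).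
  generalize (filter_and _ _ HP H0). apply filter_imp. intros z [H Hz].
  apply H. apply args_lt_1. lra.
Qed.

Lemma at_exp_lim (T : nat -> R -> R) k l : filterlim (T k) (at_left 1) (locally l) ->
  filterlim (at_exp T k) (at_right 0) (locally l).
Proof. intros H. exact (filterlim_comp _ _ _ _ _ _ _ _ exp_m2z_at_left H). Qed.

Definition vz (z : R) : R := 1 - exp (- (2 * z)).

Lemma Lz_split z : 0 < z -> Lz z = z + ln (vz z).
Proof.
  intros Hz. destruct (args_lt_1 z Hz) as [_ H]. unfold Lz, vz.
  replace (2 * sinh z) with (exp z * (1 - exp (- (2 * z)))).
  - rewrite ln_mult, ln_exp; [easy|apply exp_pos|lra].
  - unfold sinh. replace (- (2 * z)) with (- z + - z) by ring.
    rewrite exp_plus. replace (exp z * (1 - exp (- z) * exp (- z))) with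
      (exp z - (exp z * exp (- z)) * exp (- z)) by ring.
    rewrite <- exp_plus, Rplus_opp_r, exp_0. field.
Qed.

Lemma is_derive_Lz z : 0 < z -> is_derive Lz z (wz z - 1).
Proof.
  intros Hz. destruct (args_lt_1 z Hz) as [_ H].
  apply (is_derive_ext_loc (fun u => u + ln (vz u))).
  - assert (Ho : locally z (fun u => 0 < u)) by now apply open_gt.
    revert Ho. apply filter_imp. intros u Hu. now rewrite Lz_split.
  - unfold vz, wz. auto_derive; [lra|]. unfold Rminus in *. field. lra.
Qed.

Lemma vz_lim : filterlim vz (at_right 0) (at_right 0).
Proof.
  assert (Hc : continuous vz 0).
  { apply (ex_derive_continuous (V := R_NormedModule)). unfold vz. auto_derive. easy. }
  apply filterlim_at_right_continuous in Hc. unfold vz at 2 in Hc.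
  rewrite Rmult_0_r, Ropp_0, exp_0, Rminus_diag in Hc.
  intros P HP. unfold at_right, within in HP. apply Hc in HP. unfold filtermap in *.
  assert (H0 : at_right 0 (fun z => 0 < z < 1)) by (apply at_right_0_intro; auto).
  generalize (filter_and _ _ HP H0). apply filter_imp. intros z [H Hz].
  apply H. unfold vz. assert (HH := args_lt_1 z ltac:(lra)). lra.
Qed.

Lemma id_lim : filterlim (fun z : R => z) (at_right 0) (locally 0).
Proof. apply (filterlim_at_right_continuous (fun z => z) 0). apply continuous_id. Qed.

Lemma vz_Lz_lim n : filterlim (fun z => vz z * Lz z ^ n) (at_right 0) (locally 0).
Proof.
  assert (Hv : filterlim vz (at_right 0) (locally 0)).
  { eapply filterlim_filter_le_2; [|exact vz_lim]. apply filter_le_within. }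
  assert (H : forall m, filterlim (fun z => vz z * ln (vz z) ^ m) (at_right 0) (locally 0)).
  { intros m. exact (filterlim_comp _ _ _ _ _ _ _ _ vz_lim (filterlim_mul_ln_pow m)). }
  assert (G : forall k m, filterlim (fun z => vz z * ln (vz z) ^ m * Lz z ^ k)
                (at_right 0) (locally 0)).
  { induction k as [|k IH]; intros m.
    - eapply filterlim_ext; [|exact (H m)]. intros z. simpl. ring.
    - (* split off one factor Lz z = z + ln (vz z) *)
      apply (filterlim_ext_loc (fun z => z * (vz z * ln (vz z) ^ m * Lz z ^ k)
                + vz z * ln (vz z) ^ S m * Lz z ^ k)).
      { apply at_right_0_intro. intros z Hz. simpl pow. rewrite (Lz_split z) at 3 by lra. ring. }
      replace (locally 0) with (locally (0 * 0 + 0)) by (f_equal; ring).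
      apply filterlim_Rplus; [typeclasses eauto| |apply IH].
      apply filterlim_Rmult; [typeclasses eauto|exact id_lim|apply IH]. }
  eapply filterlim_ext; [|exact (G n 0%nat)]. intros z. simpl. ring.
Qed.

(** z is comparable with 1 - exp (-2z), since 2 z = Li_1 (1 - exp (-2z)). *)
Lemma z_Lz_lim n : filterlim (fun z => z * Lz z ^ n) (at_right 0) (locally 0).
Proof.
  apply (filterlim_ext_loc (fun z => (vz z * Lz z ^ n) * (/ 2 * avg 1 inv1m (vz z)))).
  - apply at_right_0_intro. intros z Hz. destruct (args_lt_1 z ltac:(lra)) as [_ H].
    assert (E : vz z * avg 1 inv1m (vz z) = 2 * z).
    { change (li 1 (vz z) = 2 * z). unfold vz. rewrite li_1 by lra.
      replace (1 - (1 - exp (- (2 * z)))) with (exp (- (2 * z))) by ring.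
      rewrite ln_exp. ring. }
    replace (vz z * Lz z ^ n * (/ 2 * avg 1 inv1m (vz z))) with
      (Lz z ^ n * (/ 2 * (vz z * avg 1 inv1m (vz z)))) by ring.
    rewrite E. field.
  - replace (locally 0) with (locally (0 * (/ 2 * avg 1 inv1m 0))) by (f_equal; ring).
    apply filterlim_Rmult; [typeclasses eauto|apply vz_Lz_lim|].
    apply filterlim_Rmult; [typeclasses eauto|apply filterlim_const|].
    eapply filterlim_comp; [exact vz_lim|].
    apply filterlim_at_right_continuous. apply cont_lt1_avg; [exact cont_inv1m|lra].
Qed.

Notation S_far := (at_far nielsen2).
Notation S_mid := (at_mid nielsen2).
Notation S_exp := (at_exp nielsen2).
Notation Li_far := (at_far li).
Notation Li_mid := (at_mid li).
Notation Li_exp := (at_exp li).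

Lemma Li_far_1 z : 0 < z -> Li_far 1 z = - 2 * z.
Proof.
  intros Hz. destruct (args_lt_1 z Hz). unfold at_far. rewrite li_1 by lra.
  replace (1 - (1 - exp (2 * z))) with (exp (2 * z)) by ring. rewrite ln_exp. ring.
Qed.

Lemma Li_mid_1 z : 0 < z -> Li_mid 1 z = 2 * z.
Proof.
  intros Hz. destruct (args_lt_1 z Hz). unfold at_mid. rewrite li_1 by lra.
  replace (1 - (1 - exp (- (2 * z)))) with (exp (- (2 * z))) by ring. rewrite ln_exp. ring.
Qed.

Lemma Li_exp_1 z : 0 < z -> Li_exp 1 z = z - Lz z.
Proof.
  intros Hz. destruct (args_lt_1 z Hz). unfold at_exp. rewrite li_1 by lra.
  rewrite Lz_split by easy. unfold vz. ring.
Qed.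

Lemma S_far_0 z : 0 < z -> S_far 0 z = 2 * z ^ 2.
Proof.
  intros Hz. destruct (args_lt_1 z Hz). unfold at_far. rewrite nielsen2_0 by lra.
  replace (1 - (1 - exp (2 * z))) with (exp (2 * z)) by ring. rewrite ln_exp. field.
Qed.

Lemma S_mid_0 z : 0 < z -> S_mid 0 z = 2 * z ^ 2.
Proof.
  intros Hz. destruct (args_lt_1 z Hz). unfold at_mid. rewrite nielsen2_0 by lra.
  replace (1 - (1 - exp (- (2 * z)))) with (exp (- (2 * z))) by ring. rewrite ln_exp. field.
Qed.

Lemma S_exp_0 z : 0 < z -> S_exp 0 z = (Lz z - z) ^ 2 / 2.
Proof.
  intros Hz. destruct (args_lt_1 z Hz). unfold at_exp. rewrite nielsen2_0 by lra.
  rewrite Lz_split by easy. unfold vz. do 2 f_equal. ring.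
Qed.

Lemma cont_nielsen2_base : cont_lt1 (ravg log_kernel).
Proof. apply cont_lt1_ravg, cont_log_kernel. Qed.

Lemma is_derive_S_far k z : 0 < z -> is_derive (S_far (S k)) z (wz z * S_far k z).
Proof. apply is_derive_at_far, cont_nielsen2_base. Qed.

Lemma is_derive_S_mid k z : 0 < z -> is_derive (S_mid (S k)) z ((wz z - 2) * S_mid k z).
Proof. apply is_derive_at_mid, cont_nielsen2_base. Qed.

Lemma is_derive_S_exp k z : 0 < z -> is_derive (S_exp (S k)) z (-2 * S_exp k z).
Proof. apply is_derive_at_exp, cont_nielsen2_base. Qed.

Lemma is_derive_Li_far k z : 0 < z -> is_derive (Li_far (S k)) z (wz z * Li_far k z).
Proof. apply is_derive_at_far, cont_inv1m. Qed.

Lemma is_derive_Li_mid k z : 0 < z -> is_derive (Li_mid (S k)) z ((wz z - 2) * Li_mid k z).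
Proof. apply is_derive_at_mid, cont_inv1m. Qed.

Lemma is_derive_Li_exp k z : 0 < z -> is_derive (Li_exp (S k)) z (-2 * Li_exp k z).
Proof. apply is_derive_at_exp, cont_inv1m. Qed.

Lemma Li_exp_lim k : (2 <= k)%nat -> filterlim (Li_exp k) (at_right 0) (locally (zeta k)).
Proof. intros Hk. now apply at_exp_lim, li_lim_at_1. Qed.

Lemma S_exp_lim p : filterlim (S_exp (S p)) (at_right 0) (locally (double_zeta p)).
Proof. apply at_exp_lim, nielsen2_lim_at_1. Qed.

Lemma Lz_Li_exp_lim k : (2 <= k)%nat ->
  filterlim (fun z => Lz z * (Li_exp (S k) z - zeta (S k))) (at_right 0) (locally 0).
Proof.
  intros Hk. apply filterlim_locally. intros eps.
  assert (H := filterlim_Rmult _ _ _ _ _ (filterlim_const (zeta k)) (vz_Lz_lim 1)).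
  rewrite Rmult_0_r in H.
  assert (He := proj1 (filterlim_locally _ _) H eps).
  assert (H0 : at_right 0 (fun z => 0 < z < 1)) by (apply at_right_0_intro; auto).
  generalize (filter_and _ _ He H0). apply filter_imp. intros z [Hz Hz0].
  destruct (args_lt_1 z ltac:(lra)) as [_ Hy].
  assert (Hl := li_near_1 k (exp (- (2 * z))) Hk ltac:(lra)).
  fold (vz z) in Hl.
  change (Rabs (zeta k * (vz z * Lz z ^ 1) - 0) < eps) in Hz.
  change (Rabs (Lz z * (Li_exp (S k) z - zeta (S k)) - 0) < eps).
  rewrite Rminus_0_r in *. eapply Rle_lt_trans; [|exact Hz].
  rewrite Rabs_mult. rewrite pow_1.
  replace (zeta k * (vz z * Lz z)) with (Lz z * (vz z * zeta k)) by ring.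
  rewrite Rabs_mult. apply Rmult_le_compat_l; [apply Rabs_pos|].
  eapply Rle_trans; [exact Hl|apply Rle_abs].
Qed.

Lemma S_far_lim k : filterlim (S_far k) (at_right 0) (locally 0).
Proof. apply at_far_lim, cont_nielsen2_base. Qed.

Lemma S_mid_lim k : filterlim (S_mid k) (at_right 0) (locally 0).
Proof. apply at_mid_lim, cont_nielsen2_base. Qed.

Lemma Li_far_lim k : filterlim (Li_far k) (at_right 0) (locally 0).
Proof. apply at_far_lim, cont_inv1m. Qed.

Lemma Li_mid_lim k : filterlim (Li_mid k) (at_right 0) (locally 0).
Proof. apply at_mid_lim, cont_inv1m. Qed.

Lemma Lz_Li_mid_lim k : filterlim (fun z => Lz z * Li_mid k z) (at_right 0) (locally 0).
Proof.
  apply (filterlim_ext (fun z => (vz z * Lz z ^ 1) * avg k inv1m (vz z))).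
  - intros z. unfold at_mid, li, tower, vz. ring.
  - replace (locally 0) with (locally (0 * avg k inv1m 0)) by (f_equal; ring).
    apply filterlim_Rmult; [typeclasses eauto|apply vz_Lz_lim|].
    eapply filterlim_comp; [exact vz_lim|].
    apply filterlim_at_right_continuous. apply cont_lt1_avg; [exact cont_inv1m|lra].
Qed.

(** * The functional equations *)

(* keeps unification from unfolding the iterated integrals *)
Opaque at_far at_mid at_exp Lz wz.

Lemma zL_lim : filterlim (fun z => z * Lz z) (at_right 0) (locally 0).
Proof. eapply filterlim_ext; [|exact (z_Lz_lim 1)]. intros z. cbv beta. now rewrite pow_1. Qed.

Lemma filterlim_limit_eq (f : R -> R) (l l' : R) :
  filterlim f (at_right 0) (locally l) -> l = l' -> filterlim f (at_right 0) (locally l').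
Proof. now intros H <-. Qed.

Lemma Derive_S_far k z : 0 < z ->
  Derive (fun x : R => S_far (S k) x) z = wz z * S_far k z.
Proof. intros Hz. exact (is_derive_unique _ _ _ (is_derive_S_far k z Hz)). Qed.

Lemma Derive_S_mid k z : 0 < z ->
  Derive (fun x : R => S_mid (S k) x) z = (wz z - 2) * S_mid k z.
Proof. intros Hz. exact (is_derive_unique _ _ _ (is_derive_S_mid k z Hz)). Qed.

Lemma Derive_S_exp k z : 0 < z ->
  Derive (fun x : R => S_exp (S k) x) z = -2 * S_exp k z.
Proof. intros Hz. exact (is_derive_unique _ _ _ (is_derive_S_exp k z Hz)). Qed.

Lemma Derive_Li_far k z : 0 < z ->
  Derive (fun x : R => Li_far (S k) x) z = wz z * Li_far k z.
Proof. intros Hz. exact (is_derive_unique _ _ _ (is_derive_Li_far k z Hz)). Qed.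

Lemma Derive_Li_mid k z : 0 < z ->
  Derive (fun x : R => Li_mid (S k) x) z = (wz z - 2) * Li_mid k z.
Proof. intros Hz. exact (is_derive_unique _ _ _ (is_derive_Li_mid k z Hz)). Qed.

Lemma Derive_Li_exp k z : 0 < z ->
  Derive (fun x : R => Li_exp (S k) x) z = -2 * Li_exp k z.
Proof. intros Hz. exact (is_derive_unique _ _ _ (is_derive_Li_exp k z Hz)). Qed.

Lemma Derive_Lz z : 0 < z -> Derive (fun x : R => Lz x) z = wz z - 1.
Proof. intros Hz. exact (is_derive_unique _ _ _ (is_derive_Lz z Hz)). Qed.

(** Computes the derivative at a positive point, and rewrites the bottom of each tower
    (weight 1 for Li, level 0 for S) by elementary functions. *)
Ltac differentiate Hz :=
  evar_last;
  [ auto_derive;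
    [ repeat apply conj; try exact I; eexists;
      match goal with
      | |- is_derive (fun x => Lz x) _ _ => exact (is_derive_Lz _ Hz)
      | |- is_derive (fun x => at_far nielsen2 _ x) _ _ => exact (is_derive_S_far _ _ Hz)
      | |- is_derive (fun x => at_mid nielsen2 _ x) _ _ => exact (is_derive_S_mid _ _ Hz)
      | |- is_derive (fun x => at_exp nielsen2 _ x) _ _ => exact (is_derive_S_exp _ _ Hz)
      | |- is_derive (fun x => at_far li _ x) _ _ => exact (is_derive_Li_far _ _ Hz)
      | |- is_derive (fun x => at_mid li _ x) _ _ => exact (is_derive_Li_mid _ _ Hz)
      | |- is_derive (fun x => at_exp li _ x) _ _ => exact (is_derive_Li_exp _ _ Hz)
      end
    | reflexivity ]
  | rewrite ?Derive_S_far, ?Derive_S_mid, ?Derive_S_exp,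
      ?Derive_Li_far, ?Derive_Li_mid, ?Derive_Li_exp, ?Derive_Lz by exact Hz;
    rewrite ?(S_far_0 _ Hz), ?(S_mid_0 _ Hz), ?(S_exp_0 _ Hz),
      ?(Li_far_1 _ Hz), ?(Li_mid_1 _ Hz), ?(Li_exp_1 _ Hz) ].

(** Computes the limit at 0+.  The products of a power of ln(2 sinh z) with a factor
    that vanishes at 0 are recognized as a whole, since the logarithm alone diverges. *)
Ltac limit :=
  lazymatch goal with
  | |- filterlim (fun z => z * Lz z) _ _ => exact zL_lim
  | |- filterlim (fun z => z * Lz z ^ 2) _ _ => exact (z_Lz_lim 2)
  | |- filterlim (fun z => Lz z * (at_exp li _ z - _)) _ _ =>
      first [eassumption | apply Lz_Li_exp_lim; lia]
  | |- filterlim (fun z => at_far nielsen2 _ z) _ _ => apply S_far_lim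
  | |- filterlim (fun z => at_mid nielsen2 _ z) _ _ => apply S_mid_lim
  | |- filterlim (fun z => at_exp nielsen2 _ z) _ _ => apply S_exp_lim
  | |- filterlim (fun z => at_far li _ z) _ _ => apply Li_far_lim
  | |- filterlim (fun z => at_mid li _ z) _ _ => apply Li_mid_lim
  | |- filterlim (fun z => at_exp li _ z) _ _ => apply Li_exp_lim; lia
  | |- filterlim (fun z => z) _ _ => exact id_lim
  | |- filterlim (fun z => @?f z + @?g z) _ _ =>
      eapply (filterlim_Rplus _ f g); [limit|limit]
  | |- filterlim (fun z => @?f z - @?g z) _ _ =>
      eapply (filterlim_Rminus _ f g); [limit|limit]
  | |- filterlim (fun z => @?f z ^ ?n) _ _ => eapply (filterlim_Rpow _ f _ n); limit
  | |- filterlim (fun z => @?f z * @?g z) _ _ =>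
      eapply (filterlim_Rmult _ f g); [limit|limit]
  | |- filterlim (fun z => @?f z / ?k) _ _ =>
      eapply (filterlim_Rmult _ f (fun _ => / k)); [limit|limit]
  | |- filterlim (fun z => - @?f z) _ _ => eapply (filterlim_Ropp _ f); limit
  | |- filterlim (fun _ => _) _ _ => apply filterlim_const
  end.

Ltac vanish :=
  apply zero_of_derive_zero;
  [ let z := fresh "z" in let Hz := fresh "Hz" in intros z Hz; differentiate Hz
  | eapply filterlim_limit_eq; [limit|] ].

(** The combinations met when the weight-6 equation is differentiated repeatedly; the
    digit is the weight.  Every power of ln(2 sinh z) is grouped with a factor that
    vanishes at z = 0 quickly enough for the product to tend to 0. *)
Definition E2_far (z : R) : R :=
  Li_far 2 z + Li_mid 2 z + 2 * z ^ 2.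

Definition E2_refl (z : R) : R :=
  Li_mid 2 z + (Li_exp 2 z - zeta 2) - 2 * (z * Lz z) + 2 * z ^ 2.

Definition E3_far (z : R) : R :=
  S_far 1 z + S_mid 1 z - 2 * (Li_far 3 z + Li_mid 3 z) + 2 * z * (Li_far 2 z - Li_mid 2
  z).

Definition E3_mid (z : R) : R :=
  S_mid 1 z - (Li_far 3 z + Li_mid 3 z) - 2 * z * Li_mid 2 z - 4 / 3 * z ^ 3.

Definition E3_refl (z : R) : R :=
  S_mid 1 z - 2 * z * Li_mid 2 z + (Li_exp 3 z - zeta 3) + (z * Lz z) * (2 * z) + 2 * z
  * zeta 2 - 2 * z ^ 3.

Definition E3_exp (z : R) : R :=
  S_mid 1 z + S_exp 1 z - 2 * z * Li_mid 2 z + Li_mid 3 z - z * Li_exp 2 z + Li_exp 3 z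
  + Lz z * (Li_exp 2 z - zeta 2) + (z * Lz z) * (4 * z) - z * Lz z ^ 2 + 3 * zeta 2 * z
  - 2 * zeta 3 - 3 * z ^ 3.

Definition E4_far (z : R) : R :=
  S_far 2 z + S_mid 2 z - 2 * (Li_far 4 z + Li_mid 4 z) + 2 * z * (Li_far 3 z - Li_mid 3
  z) + 2 / 3 * z ^ 4.

Definition E4_mid (z : R) : R :=
  S_mid 2 z - (Li_far 4 z + Li_mid 4 z) + (Li_exp 4 z - zeta 4) - 2 * z * Li_mid 3 z -
  (z * Lz z) * (4 / 3 * z ^ 2) + 2 * zeta 3 * z - 2 * zeta 2 * z ^ 2 + 2 / 3 * z ^ 4.

Definition E4_exp (z : R) : R :=
  S_mid 2 z + S_exp 2 z - z * (2 * Li_mid 3 z + Li_exp 3 z) + Lz z * (Li_exp 3 z - zeta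
  3) + (z * Lz z) * (2 * zeta 2 - 2 * z ^ 2) + (z * Lz z ^ 2) * z - zeta 4 / 4 + 3 *
  zeta 3 * z - 2 * zeta 2 * z ^ 2 + z ^ 4.

Definition E5_far (z : R) : R :=
  S_far 3 z + S_mid 3 z - 2 * (Li_far 5 z + Li_mid 5 z) + 2 * z * (Li_far 4 z - Li_mid 4
  z) + (Li_exp 5 z - zeta 5) + (z * Lz z) * (2 / 3 * z ^ 3) + 4 / 3 * zeta 2 * z ^ 3 - 2
  * zeta 3 * z ^ 2 + 2 * zeta 4 * z - 2 / 15 * z ^ 5.

Definition E5_exp (z : R) : R :=
  - (S_mid 3 z + S_exp 3 z) + (Li_far 5 z + Li_mid 5 z + Li_exp 5 z) + z * (2 * Li_mid 4
  z + Li_exp 4 z) - Lz z * (Li_exp 4 z - zeta 4) + (z * Lz z) * (2 * zeta 2 * z - 2 *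
  zeta 3 - 2 / 3 * z ^ 3) + (z * Lz z ^ 2) * (2 / 3 * z ^ 2) - zeta 2 * zeta 3 + zeta 5
  + zeta 4 * z / 2 + 2 * zeta 3 * z ^ 2 - 2 / 3 * zeta 2 * z ^ 3 + 4 / 15 * z ^ 5.

Definition E6 (z : R) : R :=
  S_far 4 z + S_mid 4 z + S_exp 4 z - 2 * (Li_far 6 z + Li_mid 6 z + Li_exp 6 z) + z *
  (2 * Li_far 5 z - 2 * Li_mid 5 z - Li_exp 5 z) + Lz z * (Li_exp 5 z - zeta 5) + (z *
  Lz z) * (2 * zeta 4 - 2 * zeta 3 * z + 4 / 3 * zeta 2 * z ^ 2 - 2 / 15 * z ^ 4) + (z *
  Lz z ^ 2) * (z ^ 3 / 3) + z ^ 6 / 15 + 2 / 3 * zeta 3 * z ^ 3 + 3 / 2 * zeta 4 * z ^ 2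
  - 2 * zeta 2 * zeta 3 * z + zeta 5 * z + 5 / 4 * zeta 6 + zeta 3 ^ 2 / 2.

(** The inversion Li_2(1 - 1/y) + Li_2(1 - y) = - ln(y)^2 / 2 at y = e^{-2z}. *)
Lemma E2_far_zero z : 0 < z -> E2_far z = 0.
Proof. revert z. unfold E2_far. vanish; ring. Qed.

(** Euler's reflection Li_2(1 - y) + Li_2(y) = zeta(2) - ln(y) ln(1 - y). *)
Lemma E2_refl_zero z : 0 < z -> E2_refl z = 0.
Proof. revert z. unfold E2_refl. vanish; ring. Qed.

(** Li_2 is not Lipschitz at 1, so the reflection formula replaces [li_near_1]. *)
Lemma Lz_Li2_exp_lim : filterlim (fun z => Lz z * (Li_exp 2 z - zeta 2)) (at_right 0) (locally 0).
Proof.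
  apply (filterlim_ext_loc (fun z =>
    (-1) * (Lz z * Li_mid 2 z) + 2 * (z * Lz z ^ 2) - 2 * z * (z * Lz z))).
  - apply at_right_0_intro. intros z Hz.
    replace (Li_exp 2 z - zeta 2) with (- Li_mid 2 z + 2 * (z * Lz z) - 2 * z ^ 2)
      by (generalize (E2_refl_zero z ltac:(lra)); unfold E2_refl; lra).
    ring.
  - eapply filterlim_limit_eq.
    + apply filterlim_Rminus; [typeclasses eauto| |limit].
      apply filterlim_Rplus; [typeclasses eauto| |limit].
      apply filterlim_Rmult; [typeclasses eauto|limit|apply Lz_Li_mid_lim].
    + ring.
Qed.

Lemma E3_far_zero z : 0 < z -> E3_far z = 0.
Proof.
  revert z. unfold E3_far. vanish.
  - transitivity ((2 - 2 * wz z) * E2_far z); [unfold E2_far; field|].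
    rewrite E2_far_zero by easy. ring.
  - ring.
Qed.

Lemma E3_mid_zero z : 0 < z -> E3_mid z = 0.
Proof.
  revert z. unfold E3_mid. vanish.
  - transitivity (- wz z * E2_far z); [unfold E2_far; field|].
    rewrite E2_far_zero by easy. ring.
  - ring.
Qed.

Lemma E3_refl_zero z : 0 < z -> E3_refl z = 0.
Proof.
  revert z. unfold E3_refl. vanish.
  - transitivity (- 2 * E2_refl z); [unfold E2_refl; field|].
    rewrite E2_refl_zero by easy. ring.
  - ring.
Qed.

Lemma E3_exp_zero z : 0 < z -> E3_exp z = 0.
Proof.
  (* at weight 2 this limit replaces the Lipschitz bound that [limit] applies *)
  assert (HL := Lz_Li2_exp_lim).
  revert z. unfold E3_exp. vanish.
  - transitivity ((wz z - 4) * E2_refl z); [unfold E2_refl; field|].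
    rewrite E2_refl_zero by easy. ring.
  - rewrite double_zeta_0. ring.
Qed.

Lemma E4_far_zero z : 0 < z -> E4_far z = 0.
Proof.
  revert z. unfold E4_far. vanish.
  - transitivity (wz z * E3_far z - 2 * E3_mid z); [unfold E3_far, E3_mid; field|].
    rewrite E3_far_zero, E3_mid_zero by easy. ring.
  - ring.
Qed.

Lemma E4_mid_zero z : 0 < z -> E4_mid z = 0.
Proof.
  revert z. unfold E4_mid. vanish.
  - transitivity (wz z * E3_mid z - 2 * E3_refl z); [unfold E3_mid, E3_refl; field|].
    rewrite E3_mid_zero, E3_refl_zero by easy. ring.
  - ring.
Qed.

Lemma E4_exp_zero z : 0 < z -> E4_exp z = 0.
Proof.
  revert z. unfold E4_exp. vanish.
  - transitivity (wz z * E3_refl z - 2 * E3_exp z); [unfold E3_refl, E3_exp; field|].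
    rewrite E3_refl_zero, E3_exp_zero by easy. ring.
  - rewrite double_zeta_1. field.
Qed.

Lemma E5_far_zero z : 0 < z -> E5_far z = 0.
Proof.
  revert z. unfold E5_far. vanish.
  - transitivity (wz z * E4_far z - 2 * E4_mid z); [unfold E4_far, E4_mid; field|].
    rewrite E4_far_zero, E4_mid_zero by easy. ring.
  - ring.
Qed.

Lemma E5_exp_zero z : 0 < z -> E5_exp z = 0.
Proof.
  revert z. unfold E5_exp. vanish.
  - transitivity (- wz z * E4_mid z + 2 * E4_exp z); [unfold E4_mid, E4_exp; field|].
    rewrite E4_mid_zero, E4_exp_zero by easy. ring.
  - rewrite double_zeta_2. field.
Qed.

Lemma E6_zero z : 0 < z -> E6 z = 0.
Proof.
  revert z. unfold E6. vanish.
  - transitivity (wz z * E5_far z + 2 * E5_exp z); [unfold E5_far, E5_exp; field|].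
    rewrite E5_far_zero, E5_exp_zero by easy. ring.
  - rewrite double_zeta_3. field.
Qed.

Transparent at_far at_mid at_exp Lz.

Theorem lemma6p3 (z : R) (hz : 0 < z) :
  (nielsen 4 2 (RtoC (1 - exp (2 * z))) + nielsen 4 2 (RtoC (1 - exp (- (2 * z))))
     + nielsen 4 2 (RtoC (exp (- (2 * z)))))%C =
  (RtoC 2 * (Li 6 (RtoC (1 - exp (2 * z))) + Li 6 (RtoC (1 - exp (- (2 * z))))
              + Li 6 (RtoC (exp (- (2 * z)))))
   - RtoC z * (RtoC 2 * Li 5 (RtoC (1 - exp (2 * z)))
                - RtoC 2 * Li 5 (RtoC (1 - exp (- (2 * z))))
                - Li 5 (RtoC (exp (- (2 * z)))))
   - RtoC (ln (2 * sinh z)) * Li 5 (RtoC (exp (- (2 * z))))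
   + RtoC (ln (2 * sinh z)
             * (2 * z ^ 5 / 15 + zeta 5 - 2 * z * zeta 4 + 2 * z ^ 2 * zeta 3
                  - 4 * z ^ 3 / 3 * zeta 2)
           - z ^ 4 / 3 * ln (2 * sinh z) ^ 2
           - z ^ 6 / 15 - 2 * z ^ 3 / 3 * zeta 3 - 3 * z ^ 2 / 2 * zeta 4
           + 2 * z * zeta 2 * zeta 3 - z * zeta 5 - 5 / 4 * zeta 6
           - zeta 3 ^ 2 / 2)%R)%C.
Proof.
  destruct (args_lt_1 z hz) as [H1 H2].
  rewrite !(nielsen_real 3), !(Li_real 5), !(Li_real 4) by lra.
  rewrite <- ?RtoC_mult, <- ?RtoC_plus, <- ?RtoC_minus, <- ?RtoC_mult,
    <- ?RtoC_plus, <- ?RtoC_minus, <- ?RtoC_mult, <- ?RtoC_plus, <- ?RtoC_minus, <- ?RtoC_plus.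
  f_equal.
  assert (H := E6_zero z hz). unfold E6, Lz, at_far, at_mid, at_exp in H.
  apply Rminus_diag_uniq. rewrite <- H. field.
Qed.
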